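(* Suppose that $a_n\to\infty$, that $\beta_n\to\beta_\infty$ as $n\to\infty$ where $|\beta_\infty|\neq 1$, and that $(\alpha_n')\in\ell^1(\mathbb Z_+)$, $(\beta_n')\in\ell^1(\mathbb Z_+)$, $(k_n-1)\in\ell^1$. Let $\rho_0>0$ be arbitrary, let $N_0=N_0(\rho_0)$ be sufficiently large, and let $|z|<\rho_0$, where $z\in\mathbb C$ if $|\beta_\infty|>1$ and $z\in\operatorname{clos}\Pi$ if $|\beta_\infty|<1$. Let $u_n(z)$, $n\ge N_0$, be the bounded solution of the Volterra equation given in the context. Then the sequence $$f_n(z)=a_n^{-1/2}q_n(z)u_n(z),\qquad n\ge N_0,$$ extended to all $n\ge -1$ by the Jacobi equation, satisfies the Jacobi equation $$a_{n-1}f_{n-1}(z)+b_nf_n(z)+a_nf_{n+1}(z)=zf_n(z),\qquad n\in\mathbb Z_+,$$ and has the asymptotics $$f_n(z)=a_n^{-1/2}q_n(z)\big(1+o(1)\big),\qquad n\to\infty.$$ If $|\beta_\infty|>1$, then all functions $f_n(z)$ are analytic in $z$. If $|\beta_\infty|<1$, then all functions $f_n(z)$ are analytic in $z\in\Pi$ and are continuous up to the cut along $\mathbb R$.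
   Context: $\mathbb Z_+=\{0,1,2,\dots\}$; $a_n>0$ and $b_n\in\mathbb R$ for $n\in\mathbb Z_+$, and $a_{-1}>0$ is an arbitrary fixed number. For a sequence $x_n$ put $x_n'=x_{n+1}-x_n$. Notation: $$\alpha_n=\frac1{2\sqrt{a_{n-1}a_n}},\quad \beta_n=-\frac{b_n}{2\sqrt{a_{n-1}a_n}},\quad \varkappa_n=\sqrt{\frac{a_{n+1}}{a_n}},\quad k_n=\frac{\varkappa_{n-1}}{\varkappa_n}=\frac{a_n}{\sqrt{a_{n-1}a_{n+1}}}.$$ The branch of $\sqrt{z^2-1}$ on $\mathbb C\setminus[-1,1]$ is analytic and positive for $z>1$ (hence negative for $z<-1$, and equal to $\pm i\sqrt{1-\lambda^2}$ at $\lambda\pm i0$, $\lambda\in(-1,1)$). Put $\zeta(z)=z-\sqrt{z^2-1}$, $z_n=\alpha_nz+\beta_n$, $\zeta_n=\zeta(z_n)$. $\Pi=\mathbb C\setminus\mathbb R$, and $\operatorname{clos}\Pi$ is the complex plane cut along $\mathbb R$, the two edges $\lambda\pm i0$ of the cut being distinguished; for $z=\lambda\pm i0$ one sets $\zeta_n=\zeta(\alpha_n\lambda+\beta_n\pm i0)$. ''Continuous up to the cut'' means continuity on the closed upper half-plane and on the closed lower half-plane, with possibly different values on the two edges. Given $\rho_0>0$, fix $0<\varepsilon_0<\big||\beta_\infty|-1\big|$ and choose $N_0=N_0(\rho_0)\ge1$ so large that $|z_n-\beta_\infty|<\varepsilon_0$ for all $n\ge N_0$ and $|z|<\rho_0$.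 Put $q_n(z)=\zeta_{N_0}\zeta_{N_0+1}\cdots\zeta_{n-1}$ for $n\ge N_0+1$ and $q_{N_0}=1$. Volterra equation: for $n\ge N_0$, $$u_n(z)=1+\sum_{m=n+1}^\infty G_{n,m}(z)r_m(z)u_m(z),$$ where $r_m(z)=(\zeta_{m-1}^{-1}-\zeta_m^{-1})+(k_m-1)\zeta_m$, $\sigma_p=\zeta_p\zeta_{p-1}$ and $$G_{n,m}(z)=-\varkappa_{m-1}^{-1}\zeta_m^{-1}\sum_{p=n+1}^m\varkappa_{p-1}\,\sigma_p\sigma_{p+1}\cdots\sigma_m,\qquad m>n.$$ For $N_0$ sufficiently large, this equation has a unique bounded solution. *)

(* Defs.v *)
(* Uses Stdlib's R and Coquelicot's C. *)
From Stdlib Require Import Reals ZArith Arith Lra Lia.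
From Coquelicot Require Import Coquelicot.
Open Scope R_scope.

(* The cut plane is covered by two closed half-planes; the point x + i0 is the
   pair (Upper, x) and x - i0 is (Lower, x). *)
Inductive edge : Set := Upper | Lower.

Definition side (e : edge) : R := match e with Upper => 1 | Lower => -1 end.

Definition closed_half_plane (e : edge) (z : C) : Prop := 0 <= side e * Im z.
Definition open_half_plane (e : edge) (z : C) : Prop := 0 < side e * Im z.

(* Sign of y, where y = 0 is read as y = +0 or y = -0 according to the edge. *)
Definition sgn_edge (e : edge) (y : R) : R :=
  if Rlt_dec 0 y then 1 else if Rlt_dec y 0 then -1 else side e.

(* Principal square root on C \ (-oo,0]; on the negative half-line it takes the
   boundary value from the half-plane e. *)
Definition Csqrt (e : edge) (w : C) : C :=
  (sqrt ((Cmod w + Re w) / 2), sgn_edge e (Im w) * sqrt ((Cmod w - Re w) / 2)).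

(* sqrt(z-1) sqrt(z+1): on (-oo,-1) both factors jump, and the jumps cancel, so
   the product is analytic off [-1,1] and depends on e only on (-1,1). *)
Definition sqrt_z2m1 (e : edge) (z : C) : C :=
  (Csqrt e (z - 1) * Csqrt e (z + 1))%C.

Definition zeta (e : edge) (z : C) : C := (z - sqrt_z2m1 e z)%C.

Lemma Csqrt_sqr (e : edge) (w : C) : (Csqrt e w * Csqrt e w = w)%C.
Proof.
destruct w as [x y].
assert (Hs : sgn_edge e y * sgn_edge e y = 1).
{ unfold sgn_edge; destruct (Rlt_dec 0 y), (Rlt_dec y 0), e; simpl; lra. }
assert (Hy : sgn_edge e y * Rabs y = y).
{ unfold sgn_edge; destruct (Rlt_dec 0 y) as [H|H];
    [rewrite Rabs_pos_eq by lra; lra|].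
  destruct (Rlt_dec y 0) as [H'|H']; [rewrite Rabs_left by lra; lra|].
  replace y with 0 by lra; rewrite Rabs_R0; lra. }
assert (Hx : Rabs x <= Cmod (x, y)) by exact (re_le_Cmod (x, y)).
assert (H2 : Cmod (x, y) * Cmod (x, y) = x * x + y * y).
{ unfold Cmod; simpl; rewrite sqrt_sqrt; nra. }
assert (Hlo : 0 <= (Cmod (x, y) + x) / 2 /\ 0 <= (Cmod (x, y) - x) / 2).
{ unfold Rabs in Hx; destruct (Rcase_abs x); lra. }
assert (Hp : sqrt ((Cmod (x, y) + x) / 2) * sqrt ((Cmod (x, y) - x) / 2)
             = Rabs y / 2).
{ rewrite <- sqrt_mult by tauto.
  replace ((Cmod (x, y) + x) / 2 * ((Cmod (x, y) - x) / 2))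
    with (Rsqr (y / 2)) by (unfold Rsqr; nra).
  rewrite sqrt_Rsqr_abs; unfold Rdiv; rewrite Rabs_mult, (Rabs_pos_eq (/ 2)); lra. }
unfold Csqrt, Cmult; simpl.
set (p := sqrt ((Cmod (x, y) + x) / 2)) in *.
set (m := sqrt ((Cmod (x, y) - x) / 2)) in *.
assert (Hpp : p * p = (Cmod (x, y) + x) / 2) by (apply sqrt_sqrt; tauto).
assert (Hmm : m * m = (Cmod (x, y) - x) / 2) by (apply sqrt_sqrt; tauto).
set (s := sgn_edge e y) in *.
f_equal.
- replace (p * p - s * m * (s * m)) with (p * p - (s * s) * (m * m)) by ring.
  rewrite Hs; lra.
- replace (p * (s * m) + s * m * p) with (2 * s * (p * m)) by ring.
  rewrite Hp; lra.
Qed.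

Lemma sqrt_z2m1_sqr (e : edge) (z : C) :
  (sqrt_z2m1 e z * sqrt_z2m1 e z = z * z - 1)%C.
Proof.
unfold sqrt_z2m1.
transitivity ((Csqrt e (z - 1) * Csqrt e (z - 1))
              * (Csqrt e (z + 1) * Csqrt e (z + 1)))%C; [ring|].
rewrite !Csqrt_sqr; ring.
Qed.

Lemma Csqrt_nonneg (e : edge) (x : R) : 0 <= x -> Csqrt e (RtoC x) = RtoC (sqrt x).
Proof.
intros Hx; unfold Csqrt; rewrite Cmod_R, Rabs_pos_eq by lra; simpl.
replace ((x + x) / 2) with x by field; replace ((x - x) / 2) with 0 by field.
rewrite sqrt_0, Rmult_0_r; reflexivity.
Qed.

Lemma Csqrt_neg (e : edge) (x : R) :
  x <= 0 -> Csqrt e (RtoC x) = (0, side e * sqrt (- x)).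
Proof.
intros Hx; unfold Csqrt; rewrite Cmod_R, Rabs_left1 by lra; simpl.
replace ((- x + x) / 2) with 0 by field.
replace ((- x - x) / 2) with (- x) by field.
unfold sgn_edge; destruct (Rlt_dec 0 0); [lra|].
rewrite sqrt_0; reflexivity.
Qed.

Lemma sqrt_z2m1_gt1 (e : edge) (x : R) :
  1 < x -> sqrt_z2m1 e (RtoC x) = RtoC (sqrt (x ^ 2 - 1)).
Proof.
intros Hx; unfold sqrt_z2m1.
rewrite <- RtoC_minus, <- RtoC_plus, !Csqrt_nonneg by lra.
rewrite <- RtoC_mult, <- sqrt_mult by lra; do 2 f_equal; ring.
Qed.

Lemma sqrt_z2m1_ltN1 (e : edge) (x : R) :
  x < -1 -> sqrt_z2m1 e (RtoC x) = RtoC (- sqrt (x ^ 2 - 1)).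
Proof.
intros Hx; unfold sqrt_z2m1.
rewrite <- RtoC_minus, <- RtoC_plus, !Csqrt_neg by lra.
replace (x ^ 2 - 1) with (- (x - 1) * - (x + 1)) by ring.
rewrite sqrt_mult by lra.
unfold Cmult, RtoC; simpl; f_equal; [|ring].
destruct e; simpl; ring.
Qed.

Lemma sqrt_z2m1_cut (e : edge) (x : R) :
  -1 < x < 1 -> sqrt_z2m1 e (RtoC x) = (0, side e * sqrt (1 - x ^ 2)).
Proof.
intros Hx; unfold sqrt_z2m1.
rewrite <- RtoC_minus, <- RtoC_plus, Csqrt_neg, Csqrt_nonneg by lra.
replace (1 - x ^ 2) with (- (x - 1) * (x + 1)) by ring.
rewrite sqrt_mult by lra.
unfold Cmult, RtoC; simpl; f_equal; ring.
Qed.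

(* [prev x0 x n] is x_(n-1), with x0 in the role of x_(-1). *)
Definition prev (x0 : R) (x : nat -> R) (n : nat) : R :=
  match n with O => x0 | S m => x m end.

Definition Cprod_n_m (x : nat -> C) (n m : nat) : C :=
  Iter.iter_nat Cmult (RtoC 1) x n m.

Section Jacobi.

Variables (am1 : R) (a b : nat -> R).

Definition alpha (n : nat) : R := 1 / (2 * sqrt (prev am1 a n * a n)).
Definition beta (n : nat) : R := - (b n / (2 * sqrt (prev am1 a n * a n))).
Definition kappa (n : nat) : R := sqrt (a (S n) / a n).
Definition kk (n : nat) : R := a n / sqrt (prev am1 a n * a (S n)).

Definition z_ (n : nat) (z : C) : C := (RtoC (alpha n) * z + RtoC (beta n))%C.

(* Since alpha n > 0, the map z_ n sends x +/- i0 to z_n(x) +/- i0. *)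
Definition zeta_ (e : edge) (z : C) (n : nat) : C := zeta e (z_ n z).

(* Below N0 >= 1, so every argument of [pred] is >= 1 at the indices used. *)

Definition q (N0 : nat) (e : edge) (z : C) (n : nat) : C :=
  Cprod_n_m (zeta_ e z) N0 (pred n).

Definition sigma (e : edge) (z : C) (p : nat) : C :=
  (zeta_ e z p * zeta_ e z (pred p))%C.

Definition r (e : edge) (z : C) (m : nat) : C :=
  ((/ zeta_ e z (pred m) - / zeta_ e z m) + RtoC (kk m - 1) * zeta_ e z m)%C.

Definition G (e : edge) (z : C) (n m : nat) : C :=
  (- (/ RtoC (kappa (pred m)) * / zeta_ e z m *
      sum_n_m (fun p => RtoC (kappa (pred p)) * Cprod_n_m (sigma e z) p m)
              (S n) m))%C.

Definition volterra (N0 : nat) (e : edge) (z : C) (u : nat -> C) : Prop :=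
  forall n : nat, (N0 <= n)%nat ->
    @is_series C_AbsRing C_NormedModule
      (fun j : nat => let m := (S n + j)%nat in (G e z n m * r e z m * u m)%C)
      (u n - 1)%C.

Definition bounded_solution (N0 : nat) (e : edge) (z : C) (u : nat -> C) : Prop :=
  (exists M : R, forall n : nat, (N0 <= n)%nat -> Cmod (u n) <= M) /\
  volterra N0 e z u.

Definition jost_tail (N0 : nat) (e : edge) (z : C) (u : nat -> C) (n : nat) : C :=
  (RtoC (/ sqrt (a n)) * q N0 e z n * u n)%C.

(* [extend_down z N0 f j] is the pair (f_(N0-j), f_(N0-j+1)), for j <= N0 + 1,
   obtained by solving the Jacobi equation at n = N0, N0-1, ... for f_(n-1). *)
Fixpoint extend_down (z : C) (N0 : nat) (f : nat -> C) (j : nat) : C * C :=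
  match j with
  | O => (f N0, f (S N0))
  | S i =>
      let (x, y) := extend_down z N0 f i in
      let n := (N0 - i)%nat in
      ((((z - RtoC (b n)) * x - RtoC (a n) * y) / RtoC (prev am1 a n))%C, x)
  end.

(* The value is meaningful for n >= -1. *)
Definition jost (N0 : nat) (e : edge) (u : C -> nat -> C) (z : C) (n : Z) : C :=
  if Z_le_dec (Z.of_nat N0) n
  then jost_tail N0 e z (u z) (Z.to_nat n)
  else fst (extend_down z N0 (jost_tail N0 e z (u z))
                        (Z.to_nat (Z.of_nat N0 - n))).

(* For |binf| > 1, z ranges over the whole plane; for |binf| < 1, over the cut
   plane, i.e. over each of the two closed half-planes. *)
Definition z_domain (binf : R) (e : edge) (z : C) : Prop :=
  Rabs binf < 1 -> closed_half_plane e z.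

Definition jacobi_equation (z : C) (f : Z -> C) : Prop :=
  forall n : nat,
    (RtoC (prev am1 a n) * f (Z.of_nat n - 1)%Z + RtoC (b n) * f (Z.of_nat n)
     + RtoC (a n) * f (Z.of_nat n + 1)%Z = z * f (Z.of_nat n))%C.

Definition jost_asymptotics (N0 : nat) (e : edge) (z : C) (f : Z -> C) : Prop :=
  exists eps : nat -> C,
    filterlim eps eventually (@locally C_UniformSpace (RtoC 0)) /\
    forall n : nat, (N0 <= n)%nat ->
      f (Z.of_nat n) = (RtoC (/ sqrt (a n)) * q N0 e z n * (1 + eps n))%C.

End Jacobi.

(* Complex differentiability at every point; D is meant to be open. *)
Definition analytic_on (D : C -> Prop) (f : C -> C) : Prop :=
  forall z : C, D z -> @ex_derive C_AbsRing C_NormedModule f z.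

(* Main.v *)
Require Import Defs.
From Stdlib Require Import Reals ZArith Lra Lia IndefiniteDescription.
From Coquelicot Require Import Coquelicot.
Open Scope R_scope.

(** The recurrence 2 z_n = zeta_n + 1/zeta_n turns differences of zeta into
    differences of its argument, with the factor 1/(1 - zeta zeta'), and this
    factor is bounded on the relevant region up to the cut.  Hence zeta_n has
    bounded variation in n uniformly in z, and summation by parts against
    1/(1 - sigma_p) bounds the kernel G_{n,m} uniformly.  The Volterra operator
    is then a contraction of norm at most 1/2 on bounded sequences once N0 is
    large, and u_n is the uniform limit of iterates that are finite algebraic
    expressions in the zeta_n.  Analyticity passes to the limit by Cauchy's
    estimate for f', which follows from differentiating
    J(t) = int f(z0 + t e^{i theta}) e^{- i theta} d theta: it satisfies
    t J' = J, and J(t)/t tends to 2 pi f'(z0).  Finally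
    w_n = u_{n+1} - u_n satisfies
    w_{n-1} = zeta_{n-1} r_n u_n + k_n sigma_n w_n, which is the Jacobi
    equation. *)

(** * The function zeta *)

(** On the cut with |binf| < 1 every zeta_n with n >= N0 has modulus one, so the products sigma_p
    ... sigma_m do not decay and a termwise bound of the sum in [G] grows with its length. Only
    oscillation, the distance of sigma from 1, keeps the kernel bounded. The lower bound for 1 -
    zeta zeta' has two sources. For |binf| > 1 one modulus stays below 1. For |binf| < 1 both values
    lie in the same closed half-plane, whereas a product equal to 1 would make them conjugate and
    hence real; this is why both points must belong to the same edge. The same bound gives the
    regularity in z: the difference quotient of zeta is an explicit rational expression in its two
    values, so continuity up to the cut needs no study of the branch. Slopes in two variables
    replace derivatives because boundary points of the half-plane have to be included, and sums,
    products and inverses act on slopes there as they do inside. The Picard sums are truncated at a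
    length growing with the iteration, so that the iterates stay in this algebra and a single
    passage to the limit remains. *)

Lemma Cmod_sub_diag (z : C) : Cmod (z - z)%C = 0.
Proof. replace (z - z)%C with (RtoC 0) by ring; apply Cmod_0. Qed.

Lemma Cmod_sqr (z : C) : Cmod z * Cmod z = Re z * Re z + Im z * Im z.
Proof.
destruct z as [x y]; unfold Cmod; simpl.
rewrite sqrt_sqrt; nra.
Qed.

Lemma im_le_Cmod (z : C) : Rabs (Im z) <= Cmod z.
Proof.
exact (Rle_trans _ _ _ (Rmax_r _ _) (Rmax_Cmod z)).
Qed.

Lemma zeta_mul_add (e : edge) (z : C) :
  (zeta e z * (z + sqrt_z2m1 e z) = 1)%C.
Proof.
unfold zeta.
transitivity (z * z - sqrt_z2m1 e z * sqrt_z2m1 e z)%C; [ring|].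
rewrite sqrt_z2m1_sqr; ring.
Qed.

Lemma zeta_neq_0 (e : edge) (z : C) : zeta e z <> RtoC 0.
Proof.
intros H; generalize (zeta_mul_add e z); rewrite H, Cmult_0_l.
intros E; injection E; lra.
Qed.

(** The reciprocal is the other root of t^2 - 2 z t + 1, hence polynomial in [z] and zeta; bounding
    it takes no lower bound for zeta. *)
Lemma Cinv_zeta (e : edge) (z : C) : (/ zeta e z = RtoC 2 * z - zeta e z)%C.
Proof.
assert (H := zeta_neq_0 e z).
transitivity (/ zeta e z * (zeta e z * (z + sqrt_z2m1 e z)))%C.
- rewrite zeta_mul_add; ring.
- rewrite Cmult_assoc, Cinv_l, Cmult_1_l by assumption; unfold zeta; ring.
Qed.

Lemma zeta_quadratic (e : edge) (z : C) :
  (RtoC 2 * z * zeta e z = zeta e z * zeta e z + 1)%C.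
Proof.
assert (H := zeta_neq_0 e z).
replace (RtoC 2 * z)%C with (/ zeta e z + zeta e z)%C
  by (rewrite Cinv_zeta; ring).
field; assumption.
Qed.

(** The branch is studied through A = sqrt(z - 1) and B = sqrt(z + 1): twice zeta is (A - B)^2 and
    (A - B)(A + B) = -2, so the modulus and the half-plane of zeta are read off from the positions
    of A and B. *)
Lemma zeta_half_sqr (e : edge) (z : C) :
  (RtoC 2 * zeta e z = (Csqrt e (z - 1) - Csqrt e (z + 1))
                       * (Csqrt e (z - 1) - Csqrt e (z + 1)))%C.
Proof.
unfold zeta, sqrt_z2m1.
transitivity (Csqrt e (z - 1) * Csqrt e (z - 1)
  + Csqrt e (z + 1) * Csqrt e (z + 1)
  - RtoC 2 * (Csqrt e (z - 1) * Csqrt e (z + 1)))%C; [|ring].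
rewrite !Csqrt_sqr.
replace (RtoC 2) with (RtoC 1 + RtoC 1)%C
  by (rewrite <- RtoC_plus; f_equal; lra).
ring.
Qed.

Lemma Csqrt_sub_mul_add (e : edge) (z : C) :
  ((Csqrt e (z - 1) - Csqrt e (z + 1)) * (Csqrt e (z - 1) + Csqrt e (z + 1))
   = - RtoC 2)%C.
Proof.
transitivity (Csqrt e (z - 1) * Csqrt e (z - 1)
  - Csqrt e (z + 1) * Csqrt e (z + 1))%C; [ring|].
rewrite !Csqrt_sqr.
replace (RtoC 2) with (RtoC 1 + RtoC 1)%C
  by (rewrite <- RtoC_plus; f_equal; lra).
ring.
Qed.

(** As z - 1 and z + 1 have the same imaginary part, both roots carry the same sign [s] and lie in
    one closed quadrant. The orderings of their coordinates are the two triangle inequalities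
    between |z - 1| and |z + 1|. *)
Lemma Csqrt_z2m1_coords (e : edge) (z : C) :
  exists s p1 m1 p2 m2 : R,
    Csqrt e (z - 1) = (p1, s * m1) /\ Csqrt e (z + 1) = (p2, s * m2) /\
    s = sgn_edge e (Im z) /\ 0 <= p1 <= p2 /\ 0 <= m2 <= m1.
Proof.
destruct z as [x y]; unfold Csqrt; simpl.
replace (y + - 0) with y by ring; replace (y + 0) with y by ring.
assert (Ht : Cmod ((x, y) + 1)%C <= Cmod ((x, y) - 1)%C + 2).
{ replace ((x, y) + 1)%C with (((x, y) - 1) + RtoC 2)%C
    by (unfold Cplus, Cminus, RtoC, Cplus, Copp; simpl; f_equal; ring).
  eapply Rle_trans; [apply Cmod_triangle|].
  rewrite Cmod_R, (Rabs_pos_eq 2) by lra; lra. }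
assert (Ht' : Cmod ((x, y) - 1)%C <= Cmod ((x, y) + 1)%C + 2).
{ replace ((x, y) - 1)%C with (((x, y) + 1) + RtoC (-2))%C
    by (unfold Cplus, Cminus, RtoC, Cplus, Copp; simpl; f_equal; ring).
  eapply Rle_trans; [apply Cmod_triangle|].
  rewrite Cmod_R, (Rabs_left (-2)) by lra; lra. }
do 5 eexists; split; [reflexivity|split; [reflexivity|split; [reflexivity|]]].
repeat split; try apply sqrt_pos; apply sqrt_le_1_alt; lra.
Qed.

Lemma sgn_edge_sqr (e : edge) (y : R) : sgn_edge e y * sgn_edge e y = 1.
Proof.
unfold sgn_edge; destruct (Rlt_dec 0 y), (Rlt_dec y 0), e; simpl; lra.
Qed.

(** Numbers A, B in one closed quadrant satisfy |A - B| <= |A + B|. The product of these moduli is 2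
    and 2 |zeta| = |A - B|^2. *)
Lemma Cmod_zeta_le_1 (e : edge) (z : C) : Cmod (zeta e z) <= 1.
Proof.
destruct (Csqrt_z2m1_coords e z)
  as (s & p1 & m1 & p2 & m2 & HA & HB & Hs & Hp & Hm).
assert (H1 := f_equal Cmod (zeta_half_sqr e z)).
assert (H2 := f_equal Cmod (Csqrt_sub_mul_add e z)).
assert (HS := sgn_edge_sqr e (Im z)); rewrite <- Hs in HS.
rewrite Cmod_opp in H2.
rewrite !Cmod_mult, Cmod_R, (Rabs_pos_eq 2) in * by lra.
assert (H3 := Cmod_sqr (Csqrt e (z - 1) - Csqrt e (z + 1))%C).
assert (H4 := Cmod_sqr (Csqrt e (z - 1) + Csqrt e (z + 1))%C).
assert (P1 := Cmod_ge_0 (Csqrt e (z - 1) - Csqrt e (z + 1))%C).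
assert (P2 := Cmod_ge_0 (Csqrt e (z - 1) + Csqrt e (z + 1))%C).
set (X := Cmod (Csqrt e (z - 1) - Csqrt e (z + 1))%C) in *.
set (Y := Cmod (Csqrt e (z - 1) + Csqrt e (z + 1))%C) in *.
rewrite HA, HB in H3, H4; simpl in H3, H4.
assert (X * X <= Y * Y).
{ rewrite H3, H4.
  assert (0 <= p1 * p2) by nra. assert (0 <= m1 * m2) by nra.
  replace ((s * m1 + s * m2) * (s * m1 + s * m2))
    with ((s * s) * ((m1 + m2) * (m1 + m2))) by ring.
  replace ((s * m1 + - (s * m2)) * (s * m1 + - (s * m2)))
    with ((s * s) * ((m1 - m2) * (m1 - m2))) by ring.
  nra. }
assert (X <= Y) by nra.
nra.
Qed.

Lemma Cmod_Cinv_zeta_le (e : edge) (z : C) :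
  Cmod (/ zeta e z) <= 2 * Cmod z + 1.
Proof.
rewrite Cinv_zeta; unfold Cminus.
eapply Rle_trans; [apply Cmod_triangle|].
rewrite Cmod_opp, Cmod_mult, Cmod_R, (Rabs_pos_eq 2) by lra.
assert (H := Cmod_zeta_le_1 e z); lra.
Qed.

Lemma sgn_edge_half_plane (e : edge) (z : C) :
  closed_half_plane e z -> sgn_edge e (Im z) = side e.
Proof.
unfold closed_half_plane, sgn_edge; intros H.
destruct (Rlt_dec 0 (Im z)), (Rlt_dec (Im z) 0), e; simpl in *; lra.
Qed.

(** The imaginary part of (A - B)^2 / 2 is s (p1 - p2) (m1 - m2), and the two differences have
    opposite signs. *)
Lemma zeta_half_plane (e : edge) (z : C) :
  closed_half_plane e z -> side e * Im (zeta e z) <= 0.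
Proof.
intros H.
destruct (Csqrt_z2m1_coords e z)
  as (s & p1 & m1 & p2 & m2 & HA & HB & Hs & Hp & Hm).
rewrite sgn_edge_half_plane in Hs by assumption.
assert (H1 := f_equal Im (zeta_half_sqr e z)).
rewrite HA, HB in H1.
destruct (zeta e z) as [a b]; simpl in *.
assert (HS : s * s = 1) by (rewrite Hs; destruct e; simpl; lra).
rewrite <- Hs.
assert (E : b = s * ((p1 - p2) * (m1 - m2))) by lra.
rewrite E, <- Rmult_assoc, HS; nra.
Qed.

(* The imaginary part of [(1 - zeta zeta') conj(zeta)] is a sum of two terms of
   the same sign, because zeta and zeta' lie in the same half-plane. *)
Lemma one_sub_zeta_mul_inner (e : edge) (d : R) (z w : C) :
  0 < d < 1 -> Rabs (Re z) <= 1 - d ->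
  closed_half_plane e z -> closed_half_plane e w ->
  sqrt (1 - (1 - d) * (1 - d)) <= Cmod (1 - zeta e z * zeta e w)%C.
Proof.
intros Hd Hre Hz Hw.
assert (Yz := zeta_half_plane e z Hz). assert (Yw := zeta_half_plane e w Hw).
assert (Hq := zeta_quadratic e z).
assert (Hz1 := Cmod_zeta_le_1 e z).
assert (Hz0 : 0 < Cmod (zeta e z)) by (apply Cmod_gt_0, zeta_neq_0).
assert (HN := Cmod_sqr (zeta e z)).
set (E := (1 - zeta e z * zeta e w)%C) in *.
assert (HE : Im (E * Cconj (zeta e z))%C
             = - Im (zeta e z) - Cmod (zeta e z) * Cmod (zeta e z) * Im (zeta e w)).
{ unfold E; rewrite HN. destruct (zeta e z), (zeta e w); simpl; ring. }
assert (HI := im_le_Cmod (E * Cconj (zeta e z))%C).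
rewrite Cmod_mult, Cmod_conj in HI.
set (t := Cmod (zeta e z)) in *.
assert (HE0 := Cmod_ge_0 E).
(* Real part of the quadratic equation multiplied by the conjugate of zeta. *)
assert (Hre2 : 2 * Re z * (t * t) = Re (zeta e z) * (t * t + 1)).
{ assert (R1 := f_equal Re Hq). assert (I1 := f_equal Im Hq).
  rewrite HN. destruct (zeta e z) as [a b]; destruct z as [x y]; simpl in *.
  match type of R1 with ?l1 = _ => match type of I1 with ?l2 = _ =>
    transitivity (l1 * a + l2 * b); [ring|rewrite R1, I1; ring] end end. }
(* With t^2 + 1 >= 2 t the identity gives |Re zeta| <= (1 - d) t, so the imaginary part of zeta is
   comparable to its modulus. *)
assert (Hy : (1 - (1 - d) * (1 - d)) * (t * t) <= Im (zeta e z) * Im (zeta e z)).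
{ destruct (zeta e z) as [a b]; simpl in *.
  assert (Ha : Rabs a * (t * t + 1) = 2 * Rabs (Re z) * (t * t)).
  { rewrite <- (Rabs_pos_eq (t * t + 1)), <- Rabs_mult, <- Hre2 by nra.
    rewrite !Rabs_mult, (Rabs_pos_eq 2), (Rabs_pos_eq t) by lra; ring. }
  assert (HA := Rabs_pos a).
  assert (Haa : a * a = Rabs a * Rabs a)
    by (rewrite <- Rabs_mult; symmetry; apply Rabs_pos_eq, Rle_0_sqr).
  assert (Rabs a * (2 * t) <= 2 * (1 - d) * (t * t)).
  { apply Rle_trans with (Rabs a * (t * t + 1)).
    - apply Rmult_le_compat_l; [exact HA|].
      assert (H := Rle_0_sqr (t - 1)); unfold Rsqr in H; lra.
    - rewrite Ha; apply Rmult_le_compat_r; [apply Rle_0_sqr|lra]. }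
  assert (Rabs a <= (1 - d) * t) by nra.
  assert (Rabs a * Rabs a <= (1 - d) * t * ((1 - d) * t)) by nra.
  nra. }
assert (Hs : sqrt (1 - (1 - d) * (1 - d)) * t <= Rabs (Im (zeta e z))).
{ apply Rsqr_incr_0_var; [|apply Rabs_pos].
  rewrite <- Rsqr_abs, Rsqr_mult, Rsqr_sqrt by nra. exact Hy. }
assert (Hl : Rabs (Im (zeta e z)) <= Cmod E * t).
{ eapply Rle_trans; [|exact HI]. rewrite HE.
  destruct e; simpl in *; unfold Rabs;
    repeat destruct Rcase_abs; nra. }
apply Rmult_le_reg_r with t; [exact Hz0|lra].
Qed.

(** For t = |zeta z| the quadratic equation gives 2 (1 + d) t <= t^2 + 1, that is 2 d t <= (1 -
    t)^2. With v = d / (1 + d) one has d (1 - v) = v, so t > 1 - v would imply 2 v < v^2. Hence t <=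
    1 - v, while the other factor has modulus at most 1. *)
Lemma one_sub_zeta_mul_outer (e : edge) (d : R) (z w : C) :
  0 < d -> 1 + d <= Cmod z ->
  d / (1 + d) <= Cmod (1 - zeta e z * zeta e w)%C.
Proof.
intros Hd Hz.
assert (Hq := f_equal Cmod (zeta_quadratic e z)).
rewrite !Cmod_mult, Cmod_R, (Rabs_pos_eq 2) in Hq by lra.
assert (Ht := Cmod_triangle (zeta e z * zeta e z) 1).
rewrite <- Hq, Cmod_mult, Cmod_1 in Ht.
assert (Hz1 := Cmod_zeta_le_1 e z). assert (Hw1 := Cmod_zeta_le_1 e w).
assert (Hz0 := Cmod_ge_0 (zeta e z)). assert (Hw0 := Cmod_ge_0 (zeta e w)).
assert (Hb : Cmod 1 <= Cmod (1 - zeta e z * zeta e w)%C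
                       + Cmod (zeta e z * zeta e w)%C).
{ replace (RtoC 1) with ((1 - zeta e z * zeta e w) + zeta e z * zeta e w)%C at 1
    by ring.
  apply Cmod_triangle. }
rewrite Cmod_1, Cmod_mult in Hb.
set (t := Cmod (zeta e z)) in *.
assert (Hv : 0 < d / (1 + d) < 1).
{ split; [apply Rdiv_lt_0_compat; lra|].
  apply Rmult_lt_reg_r with (1 + d); [lra|]. field_simplify; lra. }
assert (Hvd : (d / (1 + d)) * (1 + d) = d) by (field; lra).
set (v := d / (1 + d)) in *.
assert (t <= 1 - v).
{ destruct (Rle_dec t (1 - v)) as [|H]; [assumption|exfalso].
  assert (2 * (1 + d) * t <= t * t + 1) by nra.
  assert (2 * d * t <= (1 - t) * (1 - t)) by nra.
  assert (d * t > d * (1 - v)) by nra.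
  assert ((1 - t) * (1 - t) <= v * v) by nra.
  nra. }
nra.
Qed.

(** In both cases [d] is the gap left between the disc of radius [eps0] about [binf] and the
    critical modulus 1. It bounds |Re z| from above inside and |z| from below outside. *)
Lemma one_sub_zeta_mul_bound (binf eps0 : R) :
  0 < eps0 < Rabs (Rabs binf - 1) ->
  exists c : R, 0 < c /\ forall (e : edge) (z w : C),
    Cmod (z - RtoC binf) < eps0 -> z_domain binf e z -> z_domain binf e w ->
    c <= Cmod (1 - zeta e z * zeta e w)%C.
Proof.
intros [He0 He].
destruct (Rlt_dec (Rabs binf) 1) as [Hb|Hb].
- rewrite Rabs_left in He by lra.
  set (d := 1 - Rabs binf - eps0).
  assert (Hd : 0 < d < 1) by (generalize (Rabs_pos binf); unfold d; lra).
  exists (sqrt (1 - (1 - d) * (1 - d))); split; [apply sqrt_lt_R0; nra|].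
  intros e z w Hz Dz Dw; apply one_sub_zeta_mul_inner; auto.
  assert (H := re_le_Cmod (z - RtoC binf)).
  destruct z as [x y]; simpl in *.
  assert (Rabs x <= Rabs (x + - binf) + Rabs binf).
  { replace x with ((x + - binf) + binf) at 1 by ring; apply Rabs_triang. }
  unfold d; lra.
- rewrite Rabs_pos_eq in He by lra.
  set (d := Rabs binf - 1 - eps0).
  assert (Hd : 0 < d) by (unfold d; lra).
  exists (d / (1 + d)); split; [apply Rdiv_lt_0_compat; lra|].
  intros e z w Hz _ _; apply one_sub_zeta_mul_outer; [assumption|].
  assert (H := Cmod_triangle (RtoC binf - z) z).
  replace (RtoC binf - z + z)%C with (RtoC binf) in H by ring.
  replace (RtoC binf - z)%C with (- (z - RtoC binf))%C in H by ring.
  rewrite Cmod_opp, Cmod_R in H; unfold d; lra.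
Qed.

Lemma zeta_sub (e : edge) (z w : C) :
  ((zeta e w - zeta e z) * (1 - zeta e z * zeta e w)
   = - (RtoC 2 * (zeta e z * zeta e w)) * (w - z))%C.
Proof.
assert (Hz := zeta_quadratic e z). assert (Hw := zeta_quadratic e w).
transitivity (zeta e w * (zeta e z * zeta e z + 1)
              - zeta e z * (zeta e w * zeta e w + 1))%C; [ring|].
rewrite <- Hz, <- Hw; ring.
Qed.

(** * Continuously differentiable functions of a complex variable *)

(** Convergence written with [Cmod], so that triangle inequalities apply directly along any filter;
    [clim_filterlim] translates to the standard notion. *)
Definition clim {T : Type} (F : (T -> Prop) -> Prop) (g : T -> C) (l : C) : Prop :=
  forall eps : R, 0 < eps -> F (fun t => Cmod (g t - l)%C < eps).

Lemma clim_filterlim {T : Type} (F : (T -> Prop) -> Prop) {FF : Filter F}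
  (g : T -> C) (l : C) :
  clim F g l <-> filterlim g F (@locally C_UniformSpace l).
Proof.
rewrite (@filterlim_locally_ball_norm C_AbsRing T C_NormedModule F FF g l).
split; intros H eps.
- exact (H eps (cond_pos eps)).
- intros He; exact (H (mkposreal eps He)).
Qed.

Section Clim.

Context {T : Type} {F : (T -> Prop) -> Prop} {FF : Filter F}.

Lemma clim_const (c : C) : clim F (fun _ => c) c.
Proof.
intros eps He; apply filter_forall; intros _.
rewrite Cmod_sub_diag; exact He.
Qed.

Lemma clim_ext (g h : T -> C) (l : C) :
  F (fun t => g t = h t) -> clim F g l -> clim F h l.
Proof.
intros H Hg eps He; generalize (filter_and _ _ H (Hg eps He)).
apply filter_imp; intros t [E Ht]; rewrite <- E; exact Ht.
Qed.

Lemma clim_plus (g h : T -> C) (l m : C) :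
  clim F g l -> clim F h m -> clim F (fun t => g t + h t)%C (l + m)%C.
Proof.
intros Hg Hh eps He.
assert (He2 : 0 < eps / 2) by lra.
generalize (filter_and _ _ (Hg _ He2) (Hh _ He2)).
apply filter_imp; intros t [H1 H2]. cbv beta in *.
replace (g t + h t - (l + m))%C with ((g t - l) + (h t - m))%C by ring.
eapply Rle_lt_trans; [apply Cmod_triangle|lra].
Qed.

Lemma clim_mult_0 (g h : T -> C) (B : R) :
  clim F g (RtoC 0) -> F (fun t => Cmod (h t) <= B) ->
  clim F (fun t => g t * h t)%C (RtoC 0).
Proof.
intros Hg Hh eps He.
assert (HB : 0 < Rabs B + 1) by (generalize (Rabs_pos B); lra).
assert (He' : 0 < eps / (Rabs B + 1)) by (apply Rdiv_lt_0_compat; lra).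
generalize (filter_and _ _ (Hg _ He') Hh).
apply filter_imp; intros t [H1 H2]. cbv beta in *.
replace (g t * h t - 0)%C with (g t * h t)%C by ring.
replace (g t - 0)%C with (g t) in H1 by ring.
rewrite Cmod_mult.
assert (H3 := Cmod_ge_0 (h t)). assert (H4 := Rle_abs B).
assert (H5 := Cmod_ge_0 (g t)).
apply Rle_lt_trans with (Cmod (g t) * (Rabs B + 1)).
- apply Rmult_le_compat_l; lra.
- apply Rlt_le_trans with (eps / (Rabs B + 1) * (Rabs B + 1)).
  + apply Rmult_lt_compat_r; lra.
  + right; field; lra.
Qed.

Lemma clim_bounded (g : T -> C) (l : C) :
  clim F g l -> F (fun t => Cmod (g t) <= Cmod l + 1).
Proof.
intros Hg; generalize (Hg 1 Rlt_0_1); apply filter_imp; intros t H. cbv beta in *.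
replace (g t) with ((g t - l) + l)%C by ring.
eapply Rle_trans; [apply Cmod_triangle|lra].
Qed.

Lemma clim_sub_0 (g : T -> C) (l : C) :
  clim F g l -> clim F (fun t => g t - l)%C (RtoC 0).
Proof.
intros Hg; replace (RtoC 0) with (l + - l)%C by ring.
apply clim_plus; [exact Hg|apply clim_const].
Qed.

Lemma clim_mult (g h : T -> C) (l m : C) :
  clim F g l -> clim F h m -> clim F (fun t => g t * h t)%C (l * m)%C.
Proof.
intros Hg Hh.
apply clim_ext with (fun t => ((g t - l) * h t + (h t - m) * l) + l * m)%C.
{ apply filter_forall; intros t; ring. }
replace (l * m)%C with ((0 + 0) + l * m)%C at 1 by ring.
apply clim_plus; [apply clim_plus|apply clim_const].
- apply clim_mult_0 with (Cmod m + 1);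
    [apply clim_sub_0, Hg|apply clim_bounded, Hh].
- apply clim_mult_0 with (Cmod l);
    [apply clim_sub_0, Hh|apply filter_forall; intros; lra].
Qed.

Lemma clim_inv (g : T -> C) (l : C) :
  l <> RtoC 0 -> clim F g l -> clim F (fun t => / g t)%C (/ l)%C.
Proof.
intros Hl Hg.
assert (H0 := proj1 (Cmod_gt_0 l) Hl).
assert (Hlow : F (fun t => Cmod l / 2 <= Cmod (g t))).
{ assert (H2 : 0 < Cmod l / 2) by lra.
  generalize (Hg _ H2); apply filter_imp; intros t Ht. cbv beta in *.
  assert (H := Cmod_triangle (l - g t) (g t)).
  replace (l - g t + g t)%C with l in H by ring.
  replace (l - g t)%C with (- (g t - l))%C in H by ring.
  rewrite Cmod_opp in H; lra. }
apply clim_ext with (fun t => (g t - l) * (- (/ g t * / l)) + / l)%C.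
{ revert Hlow; apply filter_imp; intros t Ht. cbv beta in *.
  field; split; [apply Cmod_gt_0; lra|exact Hl]. }
replace (/ l)%C with (0 + / l)%C at 1 by ring.
apply clim_plus; [|apply clim_const].
apply clim_mult_0 with (/ (Cmod l / 2) * / Cmod l); [apply clim_sub_0, Hg|].
revert Hlow; apply filter_imp; intros t Ht. cbv beta in *.
rewrite Cmod_opp, Cmod_mult, !Cmod_inv; [|assumption|apply Cmod_gt_0; lra].
apply Rmult_le_compat_r; [apply Rlt_le, Rinv_0_lt_compat, H0|].
apply Rinv_le_contravar; lra.
Qed.

End Clim.

(** The two points move independently inside [D] and may coincide, so a limit along this filter
    controls the slope on the diagonal too, that is, the derivative. *)
Definition near2 (D : C -> Prop) (z w : C) (P : C * C -> Prop) : Prop :=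
  exists delta : R, 0 < delta /\ forall z' w' : C, D z' -> D w' ->
    Cmod (z' - z)%C < delta -> Cmod (w' - w)%C < delta -> P (z', w').

Global Instance near2_filter (D : C -> Prop) (z w : C) : Filter (near2 D z w).
Proof.
split.
- exists 1; split; [lra|trivial].
- intros P Q (d1 & H1 & HP) (d2 & H2 & HQ).
  exists (Rmin d1 d2); split; [apply Rmin_pos; assumption|].
  intros z' w' Dz Dw Hz Hw.
  assert (Hm1 := Rmin_l d1 d2). assert (Hm2 := Rmin_r d1 d2).
  split; [apply HP|apply HQ]; auto; lra.
- intros P Q HPQ (d1 & H1 & HP); exists d1; split; [assumption|auto].
Qed.

(* On an open set, a slope that is continuous in both variables, up to the
   diagonal, amounts to continuous complex differentiability. On a set with
   boundary the class is still stable under the algebraic operations. *)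
Definition slope_on (D : C -> Prop) (f : C -> C) (F : C -> C -> C) : Prop :=
  (forall z w : C, D z -> D w -> f w - f z = F z w * (w - z))%C /\
  (forall z w : C, D z -> D w ->
     clim (near2 D z w) (fun p => F (fst p) (snd p)) (F z w)).

Definition C1_on (D : C -> Prop) (f : C -> C) : Prop :=
  exists F : C -> C -> C, slope_on D f F.

(** The slope is bounded near the diagonal point (w, w), and f w' - f w = F w w' (w' - w). *)
Lemma slope_continuous_snd (D : C -> Prop) (f : C -> C) (F : C -> C -> C) (z w : C) :
  slope_on D f F -> D z -> D w ->
  clim (near2 D z w) (fun p => f (snd p)) (f w).
Proof.
intros [H1 H2] Dz Dw.
apply clim_ext with (fun p => (snd p - w) * F w (snd p) + f w)%C.
{ exists 1; split; [lra|]; intros z' w' _ Dw' _ _; simpl.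
  rewrite Cmult_comm, <- H1 by assumption; ring. }
replace (f w) with (0 + f w)%C at 1 by ring.
apply clim_plus; [|apply clim_const].
apply clim_mult_0 with (Cmod (F w w) + 1).
- intros eps He; exists eps; split; [assumption|].
  intros z' w' _ _ _ Hw; simpl; replace (w' - w - 0)%C with (w' - w)%C by ring.
  exact Hw.
- destruct (clim_bounded _ _ (H2 w w Dw Dw)) as (d & Hd & H).
  exists d; split; [assumption|]; intros z' w' Dz' Dw' _ Hw; simpl.
  apply (H w w'); auto.
  rewrite Cmod_sub_diag; exact Hd.
Qed.

Lemma near2_swap (D : C -> Prop) (z w : C) (g : C * C -> C) (l : C) :
  clim (near2 D w z) (fun p => g (snd p, fst p)) l -> clim (near2 D z w) g l.
Proof.
intros H eps He; destruct (H eps He) as (d & Hd & H1).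
exists d; split; [assumption|]; intros z' w' Dz Dw Hz Hw.
exact (H1 w' z' Dw Dz Hw Hz).
Qed.

Lemma slope_continuous_fst (D : C -> Prop) (f : C -> C) (F : C -> C -> C) (z w : C) :
  slope_on D f F -> D z -> D w ->
  clim (near2 D z w) (fun p => f (fst p)) (f z).
Proof.
intros H Dz Dw; apply near2_swap; simpl.
apply slope_continuous_snd with F; assumption.
Qed.

Lemma C1_const (D : C -> Prop) (c : C) : C1_on D (fun _ => c).
Proof.
exists (fun _ _ => RtoC 0); split; intros; [ring|apply clim_const].
Qed.

Lemma C1_id (D : C -> Prop) : C1_on D (fun z => z).
Proof.
exists (fun _ _ => RtoC 1); split; intros; [ring|apply clim_const].
Qed.

Lemma C1_plus (D : C -> Prop) (f g : C -> C) :
  C1_on D f -> C1_on D g -> C1_on D (fun z => f z + g z)%C.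
Proof.
intros [F [F1 F2]] [H [H1 H2]]; exists (fun z w => F z w + H z w)%C; split.
- intros z w Dz Dw.
  replace (f w + g w - (f z + g z))%C with ((f w - f z) + (g w - g z))%C by ring.
  rewrite F1, H1 by assumption; ring.
- intros z w Dz Dw; apply clim_plus; [apply F2|apply H2]; assumption.
Qed.

Lemma C1_mult (D : C -> Prop) (f g : C -> C) :
  C1_on D f -> C1_on D g -> C1_on D (fun z => f z * g z)%C.
Proof.
intros [F HF] [H HH]; exists (fun z w => F z w * g w + f z * H z w)%C; split.
- intros z w Dz Dw.
  replace (f w * g w - f z * g z)%C with ((f w - f z) * g w + f z * (g w - g z))%C
    by ring.
  rewrite (proj1 HF), (proj1 HH) by assumption; ring.
- intros z w Dz Dw; apply clim_plus; apply clim_mult.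
  + apply HF; assumption.
  + apply slope_continuous_snd with H; assumption.
  + apply slope_continuous_fst with F; assumption.
  + apply HH; assumption.
Qed.

Lemma C1_inv (D : C -> Prop) (f : C -> C) :
  (forall z, D z -> f z <> RtoC 0) -> C1_on D f -> C1_on D (fun z => / f z)%C.
Proof.
intros Hf [F HF]; exists (fun z w => - RtoC 1 * F z w * (/ f z * / f w))%C; split.
- intros z w Dz Dw.
  transitivity (- RtoC 1 * (f w - f z) * (/ f z * / f w))%C.
  + field; split; apply Hf; assumption.
  + rewrite (proj1 HF) by assumption; ring.
- intros z w Dz Dw; apply clim_mult; [apply clim_mult; [apply clim_const|]|].
  + apply HF; assumption.
  + apply clim_mult; apply clim_inv; auto.
    * apply slope_continuous_fst with F; assumption.
    * apply slope_continuous_snd with F; assumption.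
Qed.

Lemma C1_ext (D : C -> Prop) (f g : C -> C) :
  (forall z, D z -> f z = g z) -> C1_on D f -> C1_on D g.
Proof.
intros H [F [F1 F2]]; exists F; split; [|exact F2].
intros z w Dz Dw; rewrite <- !H by assumption; apply F1; assumption.
Qed.

Lemma C1_subset (D D' : C -> Prop) (f : C -> C) :
  (forall z, D' z -> D z) -> C1_on D f -> C1_on D' f.
Proof.
intros H [F [F1 F2]]; exists F; split; [auto|].
intros z w Dz Dw eps He; destruct (F2 z w (H z Dz) (H w Dw) eps He) as (d & Hd & Hp).
exists d; split; auto.
Qed.

Lemma C1_opp (D : C -> Prop) (f : C -> C) : C1_on D f -> C1_on D (fun z => - f z)%C.
Proof.
intros H; apply C1_ext with (fun z => - RtoC 1 * f z)%C.
- intros z _; ring.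
- apply C1_mult; [apply C1_const|exact H].
Qed.

Lemma C1_minus (D : C -> Prop) (f g : C -> C) :
  C1_on D f -> C1_on D g -> C1_on D (fun z => f z - g z)%C.
Proof.
intros Hf Hg; apply (C1_plus D f (fun z => - g z)%C Hf), C1_opp, Hg.
Qed.

(** * Cauchy's estimate *)

Lemma Cmod_le_Re_Im (z : C) : Cmod z <= Rabs (Re z) + Rabs (Im z).
Proof.
replace z with (RtoC (Re z) + Ci * RtoC (Im z))%C at 1.
- eapply Rle_trans; [apply Cmod_triangle|].
  rewrite Cmod_mult, Cmod_Ci, !Cmod_R; lra.
- destruct z as [x y]; unfold Cplus, Cmult, RtoC, Ci; simpl; f_equal; ring.
Qed.

Lemma ball_R_iff (x y : R) (d : R) : @ball R_UniformSpace x d y <-> Rabs (y - x) < d.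
Proof. reflexivity. Qed.

(** Derivative of a curve in C with respect to a real parameter. It is the bridge from complex
    slopes to real calculus along circles and segments. *)
Definition path_derive (g : R -> C) (s : R) (l : C) : Prop :=
  clim (locally' 0) (fun h => (g (s + h)%R - g s) * / RtoC h)%C l.

Lemma Re_Im_div_R (z : C) (h : R) : h <> 0 ->
  Re (z * / RtoC h)%C = Re z / h /\ Im (z * / RtoC h)%C = Im z / h.
Proof.
intros Hh; rewrite <- RtoC_inv by assumption; destruct z as [x y]; simpl.
split; field; assumption.
Qed.

Lemma path_derive_pair (x y : R -> R) (s l m : R) :
  is_derive x s l -> is_derive y s m -> path_derive (fun t => (x t, y t)) s (l, m).
Proof.
rewrite !is_derive_Reals; intros Hx Hy eps He.
destruct (Hx (eps / 2)) as [d1 H1]; [lra|].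
destruct (Hy (eps / 2)) as [d2 H2]; [lra|].
exists (mkposreal _ (Rmin_stable_in_posreal d1 d2)); intros h Hh Hh0.
rewrite ball_R_iff, Rminus_0_r in Hh.
specialize (H1 h Hh0 (Rlt_le_trans _ _ _ Hh (Rmin_l _ _))).
specialize (H2 h Hh0 (Rlt_le_trans _ _ _ Hh (Rmin_r _ _))).
eapply Rle_lt_trans; [apply Cmod_le_Re_Im|].
destruct (Re_Im_div_R ((x (s + h)%R, y (s + h)%R) - (x s, y s)) h Hh0) as [E1 E2].
set (q := (((x (s + h)%R, y (s + h)%R) - (x s, y s)) * / RtoC h)%C) in *.
replace (Re (q - (l, m))%C) with (Re q - l) by (destruct q; reflexivity).
replace (Im (q - (l, m))%C) with (Im q - m) by (destruct q; reflexivity).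
rewrite E1, E2; unfold Cminus, Cplus, Copp; simpl.
unfold Rminus in *; lra.
Qed.

Lemma path_derive_components (g : R -> C) (s : R) (l : C) :
  path_derive g s l ->
  is_derive (fun t => Re (g t)) s (Re l) /\ is_derive (fun t => Im (g t)) s (Im l).
Proof.
intros H; split; rewrite is_derive_Reals; intros eps He;
  destruct (H eps He) as [d Hd]; exists d; intros h Hh0 Hh;
  assert (Hb : @ball R_UniformSpace 0 d h)
    by (rewrite ball_R_iff, Rminus_0_r; exact Hh);
  specialize (Hd h Hb Hh0);
  destruct (Re_Im_div_R (g (s + h)%R - g s)%C h Hh0) as [E1 E2];
  (eapply Rle_lt_trans; [|exact Hd]).
- replace (Re (g (s + h)) - Re (g s)) with (Re (g (s + h)%R - g s)%C)
    by (destruct (g (s + h)), (g s); reflexivity).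
  rewrite <- E1; set (q := ((g (s + h)%R - g s) * / RtoC h)%C).
  replace (Re q - Re l) with (Re (q - l)%C) by (destruct q, l; reflexivity).
  apply re_le_Cmod.
- replace (Im (g (s + h)) - Im (g s)) with (Im (g (s + h)%R - g s)%C)
    by (destruct (g (s + h)), (g s); reflexivity).
  rewrite <- E2; set (q := ((g (s + h)%R - g s) * / RtoC h)%C).
  replace (Im q - Im l) with (Im (q - l)%C) by (destruct q, l; reflexivity).
  apply im_le_Cmod.
Qed.

Lemma path_derive_continuous (g : R -> C) (s : R) (l : C) :
  path_derive g s l -> clim (locally' 0) (fun h => g (s + h)%R) (g s).
Proof.
intros H.
assert (Hh : clim (locally' 0) (fun h => RtoC h) (RtoC 0)).
{ intros eps He; exists (mkposreal eps He); intros h Hb _.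
  rewrite <- RtoC_minus, Cmod_R; exact Hb. }
apply clim_ext with (fun h => (g (s + h)%R - g s) * / RtoC h * RtoC h + g s)%C.
{ exists (mkposreal 1 Rlt_0_1); intros h _ Hh0.
  field. intros E; apply Hh0; injection E; auto. }
assert (K := clim_plus _ _ _ _ (clim_mult _ _ _ _ H Hh) (clim_const (g s))).
replace (l * 0 + g s)%C with (g s) in K by ring; exact K.
Qed.

(** Chain rule: the difference quotient of f along g is F (g s) (g (s + h)) times that of g, and F
    is continuous at the diagonal point (g s, g s). *)
Lemma path_derive_comp (D : C -> Prop) (f : C -> C) (F : C -> C -> C)
  (g : R -> C) (s : R) (l : C) :
  slope_on D f F -> path_derive g s l -> locally s (fun t => D (g t)) ->
  path_derive (fun t => f (g t)) s (F (g s) (g s) * l)%C.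
Proof.
intros [H1 H2] Hg HD.
assert (Ds : D (g s)) by exact (locally_singleton _ _ HD).
assert (HD' : locally' 0 (fun h => D (g (s + h)%R))).
{ destruct HD as [d Hd]; exists d; intros h Hb _; apply Hd.
  rewrite ball_R_iff, Rminus_0_r in Hb; apply ball_R_iff.
  rewrite Rplus_minus_l; exact Hb. }
apply clim_ext with
  (fun h => F (g s) (g (s + h)%R) * ((g (s + h)%R - g s) * / RtoC h))%C.
{ revert HD'; apply filter_imp; intros h Dh.
  rewrite H1 by assumption; ring. }
apply clim_mult; [|exact Hg].
intros eps He; destruct (H2 _ _ Ds Ds eps He) as (d & Hd & HP).
generalize (filter_and _ _ HD' (path_derive_continuous _ _ _ Hg d Hd)).
apply filter_imp; intros h [Dh Hh].
apply (HP (g s) (g (s + h)%R)); auto.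
rewrite Cmod_sub_diag; exact Hd.
Qed.

(** * Polar coordinates and circle means *)

Definition polar (z0 : C) (t th : R) : C := (z0 + (t * cos th, t * sin th)%R)%C.

Lemma polar_dist (z0 : C) (t th : R) : 0 <= t -> Cmod (polar z0 t th - z0)%C = t.
Proof.
intros Ht.
replace (polar z0 t th - z0)%C with (((t * cos th)%R, (t * sin th)%R) : C)
  by (destruct z0; unfold polar, Cminus, Cplus, Copp; simpl; f_equal; ring).
unfold Cmod; simpl.
replace (t * cos th * (t * cos th * 1) + t * sin th * (t * sin th * 1))
  with (Rsqr t * (Rsqr (sin th) + Rsqr (cos th))) by (unfold Rsqr; ring).
rewrite sin2_cos2, Rmult_1_r; apply sqrt_Rsqr, Ht.
Qed.

Lemma polar_pair (z0 : C) (t th : R) :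
  polar z0 t th = (Re z0 + t * cos th, Im z0 + t * sin th).
Proof. destruct z0; reflexivity. Qed.

Lemma path_derive_polar_radius (z0 : C) (t th : R) :
  path_derive (fun u => polar z0 u th) t (cos th, sin th).
Proof.
apply (path_derive_pair (fun u => Re z0 + u * cos th) (fun u => Im z0 + u * sin th));
  auto_derive; trivial; ring.
Qed.

Lemma path_derive_polar_angle (z0 : C) (t th : R) :
  path_derive (fun v => polar z0 t v) th (- (t * sin th), t * cos th).
Proof.
apply (path_derive_pair (fun v => Re z0 + t * cos v) (fun v => Im z0 + t * sin v));
  auto_derive; trivial; ring.
Qed.

Lemma polar_continuous (z0 : C) (t th d : R) :
  0 < d -> locally_2d (fun u v => Cmod (polar z0 u v - polar z0 t th)%C < d) t th.
Proof.
intros Hd.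
assert (H1 : continuity_2d_pt (fun u v => u * cos v) t th).
{ apply continuity_2d_pt_mult; [apply continuity_2d_pt_id1|].
  apply continuity_1d_2d_pt_comp; [apply continuity_cos|apply continuity_2d_pt_id2]. }
assert (H2 : continuity_2d_pt (fun u v => u * sin v) t th).
{ apply continuity_2d_pt_mult; [apply continuity_2d_pt_id1|].
  apply continuity_1d_2d_pt_comp; [apply continuity_sin|apply continuity_2d_pt_id2]. }
assert (Hd2 : 0 < d / 2) by lra.
generalize (locally_2d_and _ _ _ _ (H1 (mkposreal _ Hd2)) (H2 (mkposreal _ Hd2))).
apply locally_2d_impl, locally_2d_forall; intros u v [A B]; simpl in A, B.
eapply Rle_lt_trans; [apply Cmod_le_Re_Im|].
rewrite !polar_pair; simpl.
replace (Re z0 + u * cos v + - (Re z0 + t * cos th))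
  with (u * cos v - t * cos th) by ring.
replace (Im z0 + u * sin v + - (Im z0 + t * sin th))
  with (u * sin v - t * sin th) by ring.
lra.
Qed.

Section CircleMean.

Variables (D : C -> Prop) (f : C -> C) (F : C -> C -> C) (z0 : C) (rad : R).
Hypothesis Hf : slope_on D f F.
Hypothesis HD : forall z : C, Cmod (z - z0)%C < rad -> D z.

Let p := polar z0.
(** [U] and [V] are the real and imaginary parts of g = f(z0 + t e^{i theta}) e^{- i theta}. The
    complex derivative of f gives both partial derivatives of g: the radial one is f', the angular
    one is i (t f' - g). *)
Let U (t th : R) : R := Re (f (p t th)) * cos th + Im (f (p t th)) * sin th.
Let V (t th : R) : R := Im (f (p t th)) * cos th - Re (f (p t th)) * sin th.
Let F' (t th : R) : R := Re (F (p t th) (p t th)).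
Let J (t : R) : R := RInt (U t) 0 (2 * PI).

Local Lemma polar_in (t th : R) : 0 <= t < rad -> D (p t th).
Proof.
intros Ht; apply HD; unfold p; rewrite polar_dist; lra.
Qed.

Local Lemma locally_radius (t : R) : 0 < t < rad -> locally t (fun u => 0 < u < rad).
Proof.
intros Ht.
apply filter_and; [apply (open_gt 0 t)|apply (open_lt rad t)]; lra.
Qed.

Local Lemma U_derive_radius (t th : R) :
  0 < t < rad -> is_derive (fun u => U u th) t (F' t th).
Proof.
intros Ht.
assert (HDl : locally t (fun u => D (p u th))).
{ generalize (locally_radius t Ht); apply filter_imp.
  intros u Hu; apply polar_in; lra. }
destruct (path_derive_components _ _ _
  (path_derive_comp D f F _ _ _ Hf (path_derive_polar_radius z0 t th) HDl)) as [A B].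
fold p in A, B.
replace (F' t th) with
  (Re (F (p t th) (p t th) * (cos th, sin th)) * cos th
   + Im (F (p t th) (p t th) * (cos th, sin th)) * sin th).
- apply (is_derive_plus (fun u => Re (f (p u th)) * cos th)
           (fun u => Im (f (p u th)) * sin th));
    [exact (is_derive_scal_l _ _ _ (cos th) A)
    |exact (is_derive_scal_l _ _ _ (sin th) B)].
- unfold F'; destruct (F (p t th) (p t th)) as [x y]; simpl.
  transitivity (x * (Rsqr (sin th) + Rsqr (cos th))); [unfold Rsqr; ring|].
  rewrite sin2_cos2; ring.
Qed.

Local Lemma f_derive_angle (t th : R) : 0 < t < rad ->
  is_derive (fun v => Re (f (p t v))) th
    (Re (F (p t th) (p t th) * ((- (t * sin th))%R, (t * cos th)%R))%C) /\
  is_derive (fun v => Im (f (p t v))) th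
    (Im (F (p t th) (p t th) * ((- (t * sin th))%R, (t * cos th)%R))%C).
Proof.
intros Ht; apply path_derive_components.
apply (path_derive_comp D f F _ _ _ Hf (path_derive_polar_angle z0 t th)).
apply filter_forall; intros v; apply polar_in; lra.
Qed.

Local Lemma V_derive_angle (t th : R) :
  0 < t < rad -> is_derive (V t) th (t * F' t th - U t th).
Proof.
intros Ht; destruct (f_derive_angle t th Ht) as [A B].
assert (Ec := is_derive_cos th). assert (Es := is_derive_sin th).
assert (A1 := is_derive_mult _ _ _ _ _ A Es Rmult_comm).
assert (B1 := is_derive_mult _ _ _ _ _ B Ec Rmult_comm).
assert (H := is_derive_minus _ _ _ _ _ B1 A1).
evar_last; [exact H|].
unfold minus, plus, opp, mult; simpl; unfold F', U.
destruct (F (p t th) (p t th)) as [x y]; destruct (f (p t th)) as [a b]; simpl.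
transitivity (t * x * (Rsqr (sin th) + Rsqr (cos th)) - (a * cos th + b * sin th));
  [unfold Rsqr; ring|].
rewrite sin2_cos2; ring.
Qed.

Local Lemma U_continuous_angle (t th : R) : 0 < t < rad -> continuous (U t) th.
Proof.
intros Ht; destruct (f_derive_angle t th Ht) as [A B].
apply (ex_derive_continuous (U t)).
assert (A1 := is_derive_mult _ _ _ _ _ A (is_derive_cos th) Rmult_comm).
assert (B1 := is_derive_mult _ _ _ _ _ B (is_derive_sin th) Rmult_comm).
eexists; exact (is_derive_plus _ _ _ _ _ A1 B1).
Qed.

(** Differentiation under the integral sign asks for joint continuity, which comes from the
    continuity of the slope at diagonal points. *)
Local Lemma F'_continuity_2d (t th : R) : 0 < t < rad -> continuity_2d_pt F' t th.
Proof.
intros Ht eps.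
assert (Dp := polar_in t th ltac:(lra)).
destruct (proj2 Hf _ _ Dp Dp eps (cond_pos eps)) as (d & Hd & H).
destruct (polar_continuous z0 t th d Hd) as [d1 H1].
destruct (locally_radius t Ht) as [d2 H2].
exists (mkposreal _ (Rmin_stable_in_posreal d1 d2)); intros u v Hu Hv.
assert (Hu1 := Rlt_le_trans _ _ _ Hu (Rmin_l d1 d2)).
assert (Hu2 := Rlt_le_trans _ _ _ Hu (Rmin_r d1 d2)).
assert (Hv1 := Rlt_le_trans _ _ _ Hv (Rmin_l d1 d2)).
specialize (H1 u v Hu1 Hv1). specialize (H2 u Hu2). cbv beta in H2.
assert (Du : D (p u v)) by (apply polar_in; lra).
eapply Rle_lt_trans; [|exact (H (p u v) (p u v) Du Du H1 H1)].
unfold F'; simpl.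
replace (Re (F (p u v) (p u v)) - Re (F (p t th) (p t th)))
  with (Re (F (p u v) (p u v) - F (p t th) (p t th))%C)
  by (destruct (F (p u v) (p u v)), (F (p t th) (p t th)); reflexivity).
apply re_le_Cmod.
Qed.

Local Lemma F'_continuous_angle (t th : R) : 0 < t < rad -> continuous (F' t) th.
Proof.
intros Ht; apply continuity_pt_filterlim, continuity_pt_locally; intros eps.
destruct (F'_continuity_2d t th Ht eps) as [d Hd].
exists d; intros v Hv; apply Hd; [|exact Hv].
replace (t - t) with 0 by ring; rewrite Rabs_R0; apply cond_pos.
Qed.

Local Lemma ex_RInt_U (t : R) : 0 < t < rad -> ex_RInt (U t) 0 (2 * PI).
Proof.
intros Ht; apply (ex_RInt_continuous (V := R_CompleteNormedModule)).
intros th _; apply U_continuous_angle, Ht.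
Qed.

(* [t F' - U] is the angular derivative of [V], and [V] is periodic. *)
Local Lemma RInt_F' (t : R) : 0 < t < rad -> is_RInt (F' t) 0 (2 * PI) (J t / t).
Proof.
intros Ht.
assert (H : is_RInt (fun th => t * F' t th - U t th) 0 (2 * PI)
              (minus (V t (2 * PI)) (V t 0))).
{ apply (is_RInt_derive (V t)).
  - intros th _; apply V_derive_angle, Ht.
  - intros th _.
    apply (continuous_minus (fun th => t * F' t th) (U t));
      [apply (continuous_scal_r t (F' t)), F'_continuous_angle, Ht
      |apply U_continuous_angle, Ht]. }
assert (E : minus (V t (2 * PI)) (V t 0) = 0).
{ unfold V, p, polar, minus, plus, opp; simpl.
  rewrite cos_2PI, sin_2PI, cos_0, sin_0; ring. }
rewrite E in H.
assert (HU : is_RInt (U t) 0 (2 * PI) (J t))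
  by (apply (RInt_correct (V := R_CompleteNormedModule)), ex_RInt_U, Ht).
assert (H1 := is_RInt_scal _ _ _ (/ t) _ (is_RInt_plus _ _ _ _ _ _ H HU)).
unfold scal, plus in H1; simpl in H1; unfold mult in H1; simpl in H1.
replace (J t / t) with (/ t * (0 + J t)) by (unfold Rdiv; ring).
eapply is_RInt_ext; [|exact H1].
intros th _; simpl; field; lra.
Qed.

Local Lemma J_derive (t : R) : 0 < t < rad -> is_derive J t (J t / t).
Proof.
intros Ht.
assert (E : forall u th, 0 < u < rad -> Derive (fun z => U z th) u = F' u th)
  by (intros u th Hu; apply is_derive_unique, U_derive_radius, Hu).
rewrite <- (is_RInt_unique _ _ _ _ (RInt_F' t Ht)).
rewrite <- (RInt_ext (fun th => Derive (fun u => U u th) t))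
  by (intros; apply E, Ht).
apply (is_derive_RInt_param U).
- generalize (locally_radius t Ht); apply filter_imp; intros u Hu th _.
  eexists; apply U_derive_radius, Hu.
- intros th _; apply continuity_2d_pt_ext_loc with F'; [|apply F'_continuity_2d, Ht].
  destruct (locally_radius t Ht) as [d Hd].
  exists d; intros u v Hu _; symmetry; apply E, Hd, Hu.
- generalize (locally_radius t Ht); apply filter_imp; intros u Hu.
  apply ex_RInt_U, Hu.
Qed.

Local Lemma J_div_const (s t : R) : 0 < s < t -> t < rad -> J s / s = J t / t.
Proof.
intros Hst Ht.
apply (eq_is_derive (fun u => J u / u)); [|lra].
intros u Hu.
assert (H := is_derive_div J (fun u => u) u _ _ (J_derive u ltac:(lra))
               (is_derive_id u) ltac:(lra)).
evar_last; [exact H|].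
unfold one, zero; simpl; field; lra.
Qed.

(** From f(p) = f(z0) + F(z0, p) t e^{i theta}, the integrand is a pure oscillation coming from
    f(z0) plus t Re F(z0, p), and the latter is at least t (Re F(z0, z0) - eps) for small t. A
    one-sided bound is enough, since f may be rotated. *)
Local Lemma J_lower (eps : R) : 0 < eps -> 0 < rad ->
  exists d : R, 0 < d /\ forall t, 0 < t < d -> t < rad ->
    2 * PI * (Re (F z0 z0) - eps) <= J t / t.
Proof.
intros He Hrad.
assert (Dz : D z0).
{ apply HD; rewrite Cmod_sub_diag; exact Hrad. }
destruct (proj2 Hf _ _ Dz Dz eps He) as (d & Hd & H).
exists d; split; [exact Hd|]; intros t Ht Htr.
set (a := Re (f z0)); set (b := Im (f z0)); set (m := Re (F z0 z0) - eps).
(* A minorant with an explicit antiderivative; the terms from f(z0) integrate to zero over a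
   period. *)
assert (HL : is_RInt (fun th => a * cos th + b * sin th + t * m) 0 (2 * PI)
  (minus (a * sin (2 * PI) - b * cos (2 * PI) + t * m * (2 * PI))
         (a * sin 0 - b * cos 0 + t * m * 0))).
{ apply (is_RInt_derive (fun th => a * sin th - b * cos th + t * m * th)
           (fun th => a * cos th + b * sin th + t * m)).
  - intros th _; auto_derive; [trivial|ring].
  - intros th _; apply (ex_derive_continuous
      (fun th => a * cos th + b * sin th + t * m)); auto_derive; trivial. }
rewrite sin_2PI, cos_2PI, sin_0, cos_0 in HL.
assert (HU : is_RInt (U t) 0 (2 * PI) (J t))
  by (apply (RInt_correct (V := R_CompleteNormedModule)), ex_RInt_U; lra).
assert (HPI := PI_RGT_0).
assert (Hle := is_RInt_le _ _ 0 (2 * PI) _ _ ltac:(lra) HL HU).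
unfold minus, plus, opp in Hle; simpl in Hle.
apply Rmult_le_reg_r with t; [lra|].
replace (J t / t * t) with (J t) by (field; lra).
replace (2 * PI * m * t) with
  (a * 0 - b * 1 + t * m * (2 * PI) + - (a * 0 - b * 1 + t * m * 0)) by ring.
apply Hle; intros th _.
assert (Dp := polar_in t th ltac:(lra)).
assert (E := proj1 Hf z0 (p t th) Dz Dp).
assert (Hn : Cmod (F z0 (p t th) - F z0 z0)%C < eps).
{ apply (H z0 (p t th)); auto.
  - rewrite Cmod_sub_diag; exact Hd.
  - unfold p; rewrite polar_dist; lra. }
assert (Hr := Rle_lt_trans _ _ _ (re_le_Cmod _) Hn).
unfold U, a, b, m.
unfold p in E at 3; rewrite polar_pair in E.
destruct (f (p t th)) as [x y]; destruct (f z0) as [x0 y0].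
destruct (F z0 (p t th)) as [g k]; destruct (F z0 z0) as [g0 k0].
destruct z0 as [c1 c2]; simpl in *.
injection E as E1 E2.
assert (E1' : x = x0 + (g * (t * cos th) - k * (t * sin th))) by lra.
assert (E2' : y = y0 + (g * (t * sin th) + k * (t * cos th))) by lra.
rewrite E1', E2'.
assert (Hs := sin2_cos2 th). unfold Rsqr in Hs.
assert (HE : (x0 + (g * (t * cos th) - k * (t * sin th))) * cos th
             + (y0 + (g * (t * sin th) + k * (t * cos th))) * sin th
             = x0 * cos th + y0 * sin th
               + t * g * (sin th * sin th + cos th * cos th)) by ring.
rewrite HE, Hs.
apply Rabs_def2 in Hr. nra.
Qed.

Local Lemma J_upper (M t : R) :
  (forall z, Cmod (z - z0)%C < rad -> Cmod (f z) <= M) ->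
  0 < t < rad -> J t <= 2 * PI * M.
Proof.
intros HM Ht.
assert (HU : is_RInt (U t) 0 (2 * PI) (J t))
  by (apply (RInt_correct (V := R_CompleteNormedModule)), ex_RInt_U; lra).
assert (HPI := PI_RGT_0).
assert (Hle := is_RInt_le _ _ 0 (2 * PI) _ _ ltac:(lra) HU
                 (is_RInt_const 0 (2 * PI) M)).
unfold scal in Hle; simpl in Hle; unfold mult in Hle; simpl in Hle.
replace (2 * PI * M) with ((2 * PI - 0) * M) by ring.
apply Hle; intros th _.
assert (Hm : Cmod (f (p t th)) <= M)
  by (apply HM; unfold p; rewrite polar_dist; lra).
(* [U] is the real part of f times the unimodular number e^{- i theta}. *)
replace (U t th) with (Re (f (p t th) * (cos th, (- sin th)%R))%C)
  by (unfold U; destruct (f (p t th)); simpl; ring).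
eapply Rle_trans; [apply Rle_abs|].
eapply Rle_trans; [apply re_le_Cmod|].
rewrite Cmod_mult.
replace (Cmod (cos th, - sin th)) with 1; [lra|].
unfold Cmod; simpl.
replace (cos th * (cos th * 1) + - sin th * (- sin th * 1))
  with (Rsqr (sin th) + Rsqr (cos th)) by (unfold Rsqr; ring).
rewrite sin2_cos2, sqrt_1; reflexivity.
Qed.

(** J(t) / t is constant in t: at [s] it is at most 2 pi M / s, near 0 it is at least 2 pi (Re
    f'(z0) - eps / s). *)
Lemma cauchy_estimate_Re (M s : R) :
  (forall z, Cmod (z - z0)%C < rad -> Cmod (f z) <= M) ->
  0 < s < rad -> Re (F z0 z0) * s <= M.
Proof.
intros HM Hs; apply le_epsilon; intros eps He.
assert (He' : 0 < eps / s) by (apply Rdiv_lt_0_compat; lra).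
destruct (J_lower (eps / s) He' ltac:(lra)) as (d & Hd & H).
set (t := Rmin d s / 2).
assert (Ht : 0 < t /\ t < d /\ t < s).
{ unfold t; generalize (Rmin_l d s) (Rmin_r d s) (Rmin_pos d s Hd (proj1 Hs)); lra. }
assert (H1 := H t ltac:(lra) ltac:(lra)).
rewrite (J_div_const t s) in H1 by lra.
assert (H2 := J_upper M s HM Hs).
assert (HPI := PI_RGT_0).
assert (H3 : 2 * PI * (Re (F z0 z0) - eps / s) * s <= 2 * PI * M).
{ eapply Rle_trans; [|exact H2].
  replace (J s) with (J s / s * s) by (field; lra).
  apply Rmult_le_compat_r; lra. }
assert (H4 : (Re (F z0 z0) - eps / s) * s <= M).
{ apply Rmult_le_reg_l with (2 * PI); lra. }
replace ((Re (F z0 z0) - eps / s) * s) with (Re (F z0 z0) * s - eps) in H4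
  by (field; lra).
lra.
Qed.

End CircleMean.

(** Multiplying f by a unimodular constant turns bounds for real parts into bounds for moduli; both
    Cauchy's estimate and the mean value inequality are reduced to real statements in this way. *)
Lemma Cmod_rotation (w : C) : exists c : C, Cmod c = 1 /\ (c * w)%C = RtoC (Cmod w).
Proof.
destruct (Ceq_dec w 0) as [->|H].
- exists 1%C; split; [apply Cmod_1|rewrite Cmod_0; ring].
- assert (H0 := proj1 (Cmod_gt_0 w) H).
  exists (RtoC (Cmod w) / w)%C; split.
  + rewrite Cmod_div, Cmod_R, Rabs_pos_eq by (assumption || lra). field; lra.
  + field; exact H.
Qed.

Lemma cauchy_estimate (D : C -> Prop) (f : C -> C) (F : C -> C -> C) (z0 : C)
  (rad M s : R) :
  slope_on D f F ->
  (forall z, Cmod (z - z0)%C < rad -> D z) ->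
  (forall z, Cmod (z - z0)%C < rad -> Cmod (f z) <= M) ->
  0 < s < rad -> Cmod (F z0 z0) * s <= M.
Proof.
intros [H1 H2] HD HM Hs.
destruct (Cmod_rotation (F z0 z0)) as (c & Hc & E).
replace (Cmod (F z0 z0)) with (Re (c * F z0 z0)%C) by (rewrite E; reflexivity).
apply (cauchy_estimate_Re D (fun z => c * f z)%C (fun z w => c * F z w)%C z0 rad);
  auto.
- split.
  + intros z w Dz Dw; rewrite <- Cmult_assoc, <- H1 by assumption; ring.
  + intros z w Dz Dw; apply clim_mult; [apply clim_const|apply H2; assumption].
- intros z Hz; rewrite Cmod_mult, Hc, Rmult_1_l; auto.
Qed.

(** * Locally uniform limits *)

Lemma slope_mean_value (D : C -> Prop) (f : C -> C) (F : C -> C -> C) (z0 w : C)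
  (rad B : R) :
  slope_on D f F ->
  (forall z, Cmod (z - z0)%C < rad -> D z /\ Cmod (F z z) <= B) ->
  Cmod (w - z0)%C < rad ->
  Cmod (f w - f z0)%C <= B * Cmod (w - z0)%C.
Proof.
intros [H1 H2] HB Hw.
destruct (Cmod_rotation (f w - f z0)%C) as (c & Hc & E).
set (g := fun s : R => (z0 + RtoC s * (w - z0))%C).
assert (Hg : forall s, path_derive g s (w - z0)%C).
{ intros s; apply clim_ext with (fun _ => (w - z0)%C); [|apply clim_const].
  exists (mkposreal 1 Rlt_0_1); intros h _ Hh; unfold g; rewrite RtoC_plus.
  field; intros E0; apply Hh; injection E0; auto. }
assert (Hgd : forall s, Cmod (g s - z0)%C = Rabs s * Cmod (w - z0)%C).
{ intros s; replace (g s - z0)%C with (RtoC s * (w - z0))%C by (unfold g; ring).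
  rewrite Cmod_mult, Cmod_R; reflexivity. }
assert (Hcf : slope_on D (fun z => c * f z)%C (fun x y => c * F x y)%C).
{ split.
  - intros x y Dx Dy; rewrite <- Cmult_assoc, <- H1 by assumption; ring.
  - intros x y Dx Dy; apply clim_mult; [apply clim_const|apply H2; assumption]. }
assert (Hw0 := Cmod_ge_0 (w - z0)%C).
assert (Hin : forall s, Rabs s <= 1 -> Cmod (g s - z0)%C < rad).
{ intros s Hs; rewrite Hgd; nra. }
assert (HV := bounded_variation (fun s => Re (c * f (g s))%C)
  (fun s => Re (c * F (g s) (g s) * (w - z0))%C) (B * Cmod (w - z0)%C) 0 1).
rewrite !Rminus_0_r, Rabs_R1, Rmult_1_r in HV.
assert (Eg1 : g 1 = w) by (unfold g; ring).
assert (Eg0 : g 0 = z0) by (unfold g; ring).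
rewrite Eg1, Eg0 in HV.
replace (Cmod (f w - f z0)%C) with (Re (c * f w)%C - Re (c * f z0)%C).
- eapply Rle_trans; [apply Rle_abs|apply HV]; intros s Hs.
  rewrite Rminus_0_r in Hs; split.
  + assert (Hl : locally s (fun t => Rabs t * Cmod (w - z0)%C < rad)).
    { apply (open_comp (fun t => Rabs t * Cmod (w - z0)%C) (fun x => x < rad)).
      - intros t _; apply (continuous_mult (fun t => Rabs t) (fun _ => Cmod (w - z0)%C));
          [apply continuous_Rabs|apply continuous_const].
      - apply open_lt.
      - cbv beta; rewrite <- Hgd; apply Hin, Hs. }
    assert (HDl : locally s (fun t => D (g t))).
    { revert Hl; apply filter_imp; intros t Ht; apply HB; rewrite Hgd; exact Ht. }
    exact (proj1 (path_derive_components _ _ _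
             (path_derive_comp D _ _ g s _ Hcf (Hg s) HDl))).
  + eapply Rle_trans; [apply re_le_Cmod|].
    rewrite !Cmod_mult, Hc, Rmult_1_l.
    apply Rmult_le_compat_r; [exact Hw0|apply HB, Hin, Hs].
- transitivity (Re (c * (f w - f z0))%C); [|rewrite E; reflexivity].
  destruct c, (f w), (f z0); simpl; ring.
Qed.

Lemma is_lim_seq_scal_0 (c : R) (e : nat -> R) :
  is_lim_seq e 0 -> is_lim_seq (fun n => c * e n) 0.
Proof.
intros He; replace (Finite 0) with (Rbar_mult (Finite c) (Finite 0))
  by (simpl; f_equal; ring).
apply is_lim_seq_scal_l, He.
Qed.

Lemma le_of_le_add_vanishing (X A B : R) (e : nat -> R) :
  is_lim_seq e 0 -> (forall j, X <= A + B * e j) -> X <= A.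
Proof.
intros He H.
assert (HL : is_lim_seq (fun j => A + B * e j) (A + B * 0)).
{ apply is_lim_seq_plus'; [apply is_lim_seq_const|].
  apply (is_lim_seq_scal_l e B 0 He). }
assert (HL2 := is_lim_seq_le _ _ _ _ H (is_lim_seq_const X) HL).
simpl in HL2; lra.
Qed.

(** Keeps an explicit rate: letting k tend to infinity in the Cauchy condition leaves the error
    [e j]. *)
Lemma C_cauchy_cv (l : nat -> C) (e : nat -> R) :
  is_lim_seq e 0 -> (forall j k, Cmod (l k - l j)%C <= e j + e k) ->
  exists L : C, forall j, Cmod (L - l j)%C <= e j.
Proof.
intros He H.
assert (HC : forall p : C -> R,
  (forall x y, Rabs (p x - p y) <= Cmod (x - y)%C) ->
  exists L : R, is_lim_seq (fun k => p (l k)) L).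
{ intros p Hp.
  apply ex_lim_seq_cauchy_corr; intros eps.
  destruct (proj2 (is_lim_seq_spec _ _) He (pos_div_2 eps)) as [N HN].
  exists N; intros n m Hn Hm; simpl in HN.
  assert (H1 := Rle_trans _ _ _ (Hp _ _) (H m n)).
  assert (H2 := HN n Hn). assert (H3 := HN m Hm).
  rewrite Rminus_0_r in H2, H3; apply Rabs_def2 in H2; apply Rabs_def2 in H3; lra. }
destruct (HC Re) as [x Hx].
{ intros [a b] [c d]; exact (re_le_Cmod ((a, b) - (c, d))%C). }
destruct (HC Im) as [y Hy].
{ intros [a b] [c d]; exact (im_le_Cmod ((a, b) - (c, d))%C). }
exists (x, y); intros j; apply le_epsilon; intros eps Heps.
assert (Hp : 0 < eps / 3) by lra.
destruct (proj2 (is_lim_seq_spec _ _) Hx (mkposreal _ Hp)) as [N1 HN1].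
destruct (proj2 (is_lim_seq_spec _ _) Hy (mkposreal _ Hp)) as [N2 HN2].
destruct (proj2 (is_lim_seq_spec _ _) He (mkposreal _ Hp)) as [N3 HN3].
set (k := (N1 + N2 + N3)%nat).
assert (A1 := HN1 k ltac:(unfold k; lia)). assert (A2 := HN2 k ltac:(unfold k; lia)).
assert (A3 := HN3 k ltac:(unfold k; lia)).
simpl in A1, A2, A3; rewrite Rminus_0_r in A3; apply Rabs_def2 in A3.
assert (A4 := H j k).
replace ((x, y) - l j)%C with ((l k - l j) - (l k - (x, y)))%C by ring.
eapply Rle_trans; [apply Cmod_triangle|].
rewrite Cmod_opp.
assert (A5 := Cmod_le_Re_Im (l k - (x, y))%C).
replace (Re (l k - (x, y))%C) with (Re (l k) - x) in A5 by (destruct (l k); reflexivity).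
replace (Im (l k - (x, y))%C) with (Im (l k) - y) in A5 by (destruct (l k); reflexivity).
lra.
Qed.

(** Closeness of the functions becomes closeness of their derivatives on the half disc by Cauchy's
    estimate, and then a Lipschitz bound for f - fk k with constant K e k by the mean value
    inequality. The derivative of f at [z0] is the limit of the [F k z0 z0]. *)
Lemma weierstrass (D : C -> Prop) (fk : nat -> C -> C) (f : C -> C) (e : nat -> R)
  (z0 : C) (rad : R) :
  (forall k, C1_on D (fk k)) -> 0 < rad ->
  (forall z, Cmod (z - z0)%C < rad -> D z) ->
  is_lim_seq e 0 ->
  (forall k z, Cmod (z - z0)%C < rad -> Cmod (fk k z - f z)%C <= e k) ->
  exists l : C, forall eps, 0 < eps -> exists d, 0 < d /\
    forall z, Cmod (z - z0)%C < d ->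
      Cmod (f z - f z0 - l * (z - z0))%C <= eps * Cmod (z - z0)%C.
Proof.
intros HC1 Hrad HD He Hf.
destruct (functional_choice _ HC1) as [F HF].
assert (Hz0 := Cmod_sub_diag z0).
assert (Dz0 : D z0) by (apply HD; lra).
assert (Hs : forall j k, slope_on D (fun z => fk j z - fk k z)%C
                           (fun z w => F j z w - F k z w)%C).
{ intros j k; split.
  - intros z w Dz Dw.
    replace (fk j w - fk k w - (fk j z - fk k z))%C
      with ((fk j w - fk j z) - (fk k w - fk k z))%C by ring.
    rewrite (proj1 (HF j)), (proj1 (HF k)) by assumption; ring.
  - intros z w Dz Dw.
    apply clim_ext with (fun p => F j (fst p) (snd p)
                                  + - RtoC 1 * F k (fst p) (snd p))%C.
    { apply filter_forall; intros; ring. }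
    replace (F j z w - F k z w)%C with (F j z w + - RtoC 1 * F k z w)%C by ring.
    apply clim_plus; [|apply clim_mult; [apply clim_const|]]; apply HF; assumption. }
(* Around a point of the half disc a disc of radius rad / 2 is available; Cauchy's estimate is used
   there at radius rad / 4. *)
set (K := 4 / rad).
assert (HK : 0 < K) by (unfold K; apply Rdiv_lt_0_compat; lra).
assert (HF' : forall j k z, Cmod (z - z0)%C < rad / 2 ->
  Cmod (F j z z - F k z z)%C <= K * (e j + e k)).
{ intros j k z Hz.
  assert (HE := cauchy_estimate D _ _ z (rad / 2) (e j + e k) (rad / 4) (Hs j k)).
  apply Rmult_le_reg_r with (rad / 4); [lra|].
  replace (K * (e j + e k) * (rad / 4)) with (e j + e k)
    by (unfold K; field; lra).
  assert (Hin : forall w, Cmod (w - z)%C < rad / 2 -> Cmod (w - z0)%C < rad).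
  { intros w Hw; replace (w - z0)%C with ((w - z) + (z - z0))%C by ring.
    eapply Rle_lt_trans; [apply Cmod_triangle|lra]. }
  apply HE; [intros w Hw; apply HD, Hin, Hw| |lra].
  intros w Hw; replace (fk j w - fk k w)%C
    with ((fk j w - f w) + - (fk k w - f w))%C by ring.
  eapply Rle_trans; [apply Cmod_triangle|]; rewrite Cmod_opp.
  apply Rplus_le_compat; apply Hf, Hin, Hw. }
(* Mean value inequality for fk j - fk k, with j tending to infinity. *)
assert (HMV : forall k z, Cmod (z - z0)%C < rad / 2 ->
  Cmod ((f z - f z0) - (fk k z - fk k z0))%C <= K * e k * Cmod (z - z0)%C).
{ intros k z Hz.
  apply le_of_le_add_vanishing with (B := K * Cmod (z - z0)%C + 2) (e := e); [exact He|].
  intros j.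
  assert (H1 := slope_mean_value D _ _ z0 z (rad / 2) (K * (e j + e k)) (Hs j k)).
  cbv beta in H1.
  replace (f z - f z0 - (fk k z - fk k z0))%C with
    ((fk j z - fk k z - (fk j z0 - fk k z0))
     + (- (fk j z - f z) + (fk j z0 - f z0)))%C by ring.
  eapply Rle_trans; [apply Cmod_triangle|].
  assert (H2 := Cmod_triangle (- (fk j z - f z))%C (fk j z0 - f z0)%C).
  rewrite Cmod_opp in H2.
  assert (H3 := Hf j z ltac:(lra)). assert (H4 := Hf j z0 ltac:(lra)).
  assert (H5 : Cmod (fk j z - fk k z - (fk j z0 - fk k z0))%C
               <= K * (e j + e k) * Cmod (z - z0)%C).
  { apply H1; [|exact Hz]; intros w Hw; split; [apply HD; lra|apply HF', Hw]. }
  lra. }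
assert (Hcv : exists L, forall j, Cmod (L - F j z0 z0)%C <= K * e j).
{ apply (C_cauchy_cv (fun j => F j z0 z0)).
  - apply is_lim_seq_scal_0, He.
  - intros j k; rewrite <- Rmult_plus_distr_l, Rplus_comm.
    apply HF'; lra. }
destruct Hcv as [L HL]; exists L; intros eps Heps.
(* The three thirds are the Lipschitz error of f - fk k, the variation of the slope [F k] near [z0],
   and the distance from [F k z0 z0] to [L]. *)
assert (Hk : exists k, K * e k < eps / 3).
{ assert (H3 : 0 < eps / 3 / K) by (apply Rdiv_lt_0_compat; lra).
  destruct (proj2 (is_lim_seq_spec _ _) He (mkposreal _ H3)) as [N HN].
  exists N; specialize (HN N (Nat.le_refl N)); simpl in HN.
  rewrite Rminus_0_r in HN; apply Rabs_def2 in HN.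
  replace (eps / 3) with (K * (eps / 3 / K)) by (field; lra).
  apply Rmult_lt_compat_l; lra. }
destruct Hk as [k Hk].
destruct (proj2 (HF k) z0 z0 Dz0 Dz0 (eps / 3) ltac:(lra)) as (d & Hd & Hcont).
exists (Rmin d (rad / 2)); split; [apply Rmin_pos; lra|].
intros z Hz.
assert (Hz1 := Rlt_le_trans _ _ _ Hz (Rmin_l _ _)).
assert (Hz2 := Rlt_le_trans _ _ _ Hz (Rmin_r _ _)).
assert (Dz : D z) by (apply HD; lra).
assert (H1 := HMV k z Hz2).
assert (H2 : Cmod (F k z0 z - F k z0 z0)%C < eps / 3)
  by (apply (Hcont z0 z); auto; lra).
assert (H3 := HL k).
replace (f z - f z0 - L * (z - z0))%C with
  ((f z - f z0 - (fk k z - fk k z0))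
   + ((F k z0 z - F k z0 z0) - (L - F k z0 z0)) * (z - z0))%C.
- eapply Rle_trans; [apply Cmod_triangle|].
  rewrite Cmod_mult.
  assert (H4 := Cmod_triangle (F k z0 z - F k z0 z0)%C (- (L - F k z0 z0))%C).
  rewrite Cmod_opp in H4.
  change (F k z0 z - F k z0 z0 + - (L - F k z0 z0))%C
    with (F k z0 z - F k z0 z0 - (L - F k z0 z0))%C in H4.
  assert (H5 := Cmod_ge_0 (z - z0)%C).
  set (X := Cmod (F k z0 z - F k z0 z0 - (L - F k z0 z0))%C) in *.
  set (r := Cmod (z - z0)%C) in *.
  assert (X * r <= (eps / 3 + eps / 3) * r) by (apply Rmult_le_compat_r; lra).
  assert (K * e k * r <= eps / 3 * r) by (apply Rmult_le_compat_r; lra).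
  lra.
- rewrite (proj1 (HF k)) by assumption; ring.
Qed.

Lemma is_derive_C_intro (f : C -> C) (z0 l : C) :
  (forall eps, 0 < eps -> exists d, 0 < d /\
     forall z, Cmod (z - z0)%C < d ->
       Cmod (f z - f z0 - l * (z - z0))%C <= eps * Cmod (z - z0)%C) ->
  @is_derive C_AbsRing C_NormedModule f z0 l.
Proof.
intros H; split; [apply is_linear_scal_l|].
intros x Hx.
(* [is_derive] quantifies over all limits [x] of the neighbourhood filter of [z0]; there is only
   one. *)
rewrite <- (is_filter_lim_locally_unique (K := C_AbsRing)
              (V := AbsRing_NormedModule C_AbsRing) z0 x Hx).
intros eps; destruct (H eps (cond_pos eps)) as (d & Hd & Hz).
exists (mkposreal d Hd); intros z Hb.
specialize (Hz z Hb).
assert (E : (f z - f z0 - l * (z - z0))%C = (f z - f z0 - (z - z0) * l)%C) by ring.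
rewrite E in Hz; exact Hz.
Qed.

(** One class for both conclusions: it implies continuity on all of [D], boundary included, and
    differentiability at interior points. The approximants are fixed on [D]; only the radius and the
    rate are local. *)
Definition C1_limit_on (D : C -> Prop) (f : C -> C) : Prop :=
  exists fk : nat -> C -> C, (forall k, C1_on D (fk k)) /\
    forall z0, D z0 -> exists (d : R) (e : nat -> R), 0 < d /\ is_lim_seq e 0 /\
      forall k z, D z -> Cmod (z - z0)%C < d -> Cmod (fk k z - f z)%C <= e k.

Lemma C1_limit_ext (D : C -> Prop) (f g : C -> C) :
  (forall z, D z -> f z = g z) -> C1_limit_on D f -> C1_limit_on D g.
Proof.
intros H (fk & H1 & H2); exists fk; split; [exact H1|].
intros z0 Dz0; destruct (H2 z0 Dz0) as (d & e & Hd & He & Hf).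
exists d, e; repeat split; auto.
intros k z Dz Hz; rewrite <- H by assumption; auto.
Qed.

Lemma C1_limit_plus (D : C -> Prop) (f g : C -> C) :
  C1_limit_on D f -> C1_limit_on D g -> C1_limit_on D (fun z => f z + g z)%C.
Proof.
intros (fk & F1 & F2) (gk & G1 & G2).
exists (fun k z => fk k z + gk k z)%C; split; [intros k; apply C1_plus; auto|].
intros z0 Dz0.
destruct (F2 z0 Dz0) as (d & e & Hd & He & Hf).
destruct (G2 z0 Dz0) as (d' & e' & Hd' & He' & Hg).
exists (Rmin d d'), (fun k => e k + e' k); split; [apply Rmin_pos; assumption|split].
- replace 0 with (0 + 0) by ring; apply is_lim_seq_plus'; assumption.
- intros k z Dz Hz.
  replace (fk k z + gk k z - (f z + g z))%C
    with ((fk k z - f z) + (gk k z - g z))%C by ring.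
  eapply Rle_trans; [apply Cmod_triangle|].
  apply Rplus_le_compat; [apply Hf|apply Hg]; auto;
    eapply Rlt_le_trans; eauto; [apply Rmin_l|apply Rmin_r].
Qed.

Lemma C1_mult_limit (D : C -> Prop) (p f : C -> C) :
  C1_on D p -> C1_limit_on D f -> C1_limit_on D (fun z => p z * f z)%C.
Proof.
intros Hp (fk & F1 & F2).
exists (fun k z => p z * fk k z)%C; split; [intros k; apply C1_mult; auto|].
intros z0 Dz0.
destruct (F2 z0 Dz0) as (d & e & Hd & He & Hf).
destruct Hp as [P HP].
destruct (clim_bounded _ _ (slope_continuous_snd D p P z0 z0 HP Dz0 Dz0))
  as (d' & Hd' & HB).
exists (Rmin d d'), (fun k => (Cmod (p z0) + 1) * e k).
split; [apply Rmin_pos; assumption|split].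
- apply is_lim_seq_scal_0, He.
- intros k z Dz Hz.
  replace (p z * fk k z - p z * f z)%C with (p z * (fk k z - f z))%C by ring.
  rewrite Cmod_mult; apply Rmult_le_compat; try apply Cmod_ge_0.
  + apply (HB z0 z); auto; [|eapply Rlt_le_trans; eauto; apply Rmin_r].
    rewrite Cmod_sub_diag; exact Hd'.
  + apply Hf; [exact Dz|eapply Rlt_le_trans; eauto; apply Rmin_l].
Qed.

Lemma C1_limit_continuous (D : C -> Prop) (f : C -> C) :
  C1_limit_on D f -> @continuous_on C_UniformSpace C_UniformSpace D f.
Proof.
intros (fk & F1 & F2) z0 Dz0.
destruct (F2 z0 Dz0) as (d & e & Hd & He & Hf).
apply (clim_filterlim (within D (locally z0))).
intros eps Heps.
assert (H3 : 0 < eps / 3) by lra.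
destruct (proj2 (is_lim_seq_spec _ _) He (mkposreal _ H3)) as [k Hk].
specialize (Hk k (Nat.le_refl k)); simpl in Hk.
rewrite Rminus_0_r in Hk; apply Rabs_def2 in Hk.
destruct (F1 k) as [F HF].
destruct (slope_continuous_snd D _ F z0 z0 HF Dz0 Dz0 (eps / 3) H3) as (d' & Hd' & HC).
assert (Hm : 0 < Rmin d d') by (apply Rmin_pos; assumption).
apply (@locally_le_locally_norm C_AbsRing C_NormedModule).
exists (mkposreal _ Hm); intros z Hz Dz.
change (Cmod (z - z0)%C < Rmin d d') in Hz.
assert (Hz1 := Rlt_le_trans _ _ _ Hz (Rmin_l _ _)).
assert (Hz2 := Rlt_le_trans _ _ _ Hz (Rmin_r _ _)).
assert (H00 := Cmod_sub_diag z0).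
assert (A := Hf k z Dz Hz1). assert (B := Hf k z0 Dz0 ltac:(lra)).
assert (E := HC z0 z Dz0 Dz ltac:(lra) Hz2); simpl in E.
replace (f z - f z0)%C
  with ((fk k z - fk k z0) + (- (fk k z - f z) + (fk k z0 - f z0)))%C by ring.
eapply Rle_lt_trans; [apply Cmod_triangle|].
assert (G := Cmod_triangle (- (fk k z - f z))%C (fk k z0 - f z0)%C).
rewrite Cmod_opp in G; lra.
Qed.

Lemma C1_limit_ex_derive (D : C -> Prop) (f : C -> C) (z0 : C) (rad : R) :
  0 < rad -> (forall z, Cmod (z - z0)%C < rad -> D z) -> C1_limit_on D f ->
  @ex_derive C_AbsRing C_NormedModule f z0.
Proof.
intros Hrad HD (fk & F1 & F2).
assert (Dz0 : D z0).
{ apply HD; rewrite Cmod_sub_diag; exact Hrad. }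
destruct (F2 z0 Dz0) as (d & e & Hd & He & Hf).
destruct (weierstrass D fk f e z0 (Rmin d rad)) as [l Hl]; auto.
- apply Rmin_pos; assumption.
- intros z Hz; apply HD; eapply Rlt_le_trans; eauto; apply Rmin_r.
- intros k z Hz; apply Hf; [apply HD|]; eapply Rlt_le_trans; eauto;
    [apply Rmin_r|apply Rmin_l].
- exists l; apply is_derive_C_intro, Hl.
Qed.

(** * Volterra equations with a small kernel *)

(** [sum_n] specialised to C, with its recursion restated through [Cplus] so that [ring] can work on
    it. *)
Definition csum (x : nat -> C) (k : nat) : C := sum_n x k.

Lemma csum_ext (x y : nat -> C) (k : nat) :
  (forall j, x j = y j) -> csum x k = csum y k.
Proof. exact (sum_n_ext x y k). Qed.


Lemma csum_S (x : nat -> C) (k : nat) : csum x (S k) = (csum x k + x (S k))%C.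
Proof. exact (sum_Sn x k). Qed.

Lemma csum_0 (x : nat -> C) : csum x 0 = x 0%nat.
Proof. exact (sum_O x). Qed.

Lemma csum_minus (x y : nat -> C) (k : nat) :
  (csum x k - csum y k)%C = csum (fun j => x j - y j)%C k.
Proof.
induction k as [|k IH]; [rewrite !csum_0; reflexivity|].
rewrite !csum_S, <- IH; ring.
Qed.

Lemma C1_csum (D : C -> Prop) (x : nat -> C -> C) (k : nat) :
  (forall j, C1_on D (x j)) -> C1_on D (fun z => csum (fun j => x j z) k).
Proof.
intros H; induction k as [|k IH].
- apply C1_ext with (x 0%nat); [intros; rewrite csum_0; reflexivity|apply H].
- apply C1_ext with (fun z => csum (fun j => x j z) k + x (S k) z)%C.
  + intros z _; rewrite csum_S; reflexivity.
  + apply C1_plus; [exact IH|apply H].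
Qed.

Section TelescopingBounds.

Variables (x : nat -> C) (B : R) (rho : nat -> R) (p : nat).
Hypothesis Hx : forall j, Cmod (x j) <= B * (rho (p + j)%nat - rho (S (p + j))).

(** Summability is encoded by a sequence [rho] whose decrements dominate the terms, so that sums and
    tails are bounded by telescoping. *)
Lemma csum_telescope_bound (k : nat) :
  Cmod (csum x k) <= B * (rho p - rho (p + S k)%nat).
Proof.
induction k as [|k IH].
- rewrite csum_0; generalize (Hx 0).
  replace (p + 0)%nat with p by lia; replace (p + 1)%nat with (S p) by lia; trivial.
- rewrite csum_S; eapply Rle_trans; [apply Cmod_triangle|].
  generalize (Hx (S k)); replace (S (p + S k)) with (p + S (S k))%nat by lia; lra.
Qed.

Lemma csum_tail_bound (k i : nat) :
  Cmod (csum x (k + i) - csum x k)%C <= B * (rho (p + S k)%nat - rho (p + S k + i)%nat).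
Proof.
induction i as [|i IH].
- rewrite !Nat.add_0_r.
  replace (csum x k - csum x k)%C with (RtoC 0) by ring; rewrite Cmod_0; lra.
- replace (k + S i)%nat with (S (k + i)) by lia; rewrite csum_S.
  replace (csum x (k + i) + x (S (k + i)) - csum x k)%C
    with ((csum x (k + i) - csum x k) + x (S (k + i)))%C by ring.
  eapply Rle_trans; [apply Cmod_triangle|].
  generalize (Hx (S (k + i))).
  replace (p + S (k + i))%nat with (p + S k + i)%nat by lia.
  replace (p + S k + S i)%nat with (S (p + S k + i)) by lia; lra.
Qed.

End TelescopingBounds.

(** Error of a Picard iteration with contraction factor 1/2 whose i-th step also commits a
    truncation error [c * rho i]. *)
Fixpoint halving (x0 c : R) (rho : nat -> R) (k : nat) : R :=
  match k with
  | O => x0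
  | S i => halving x0 c rho i / 2 + c * rho i
  end.

Lemma halving_lim (x0 c : R) (rho : nat -> R) :
  0 <= x0 -> 0 <= c -> (forall n, 0 <= rho n) -> is_lim_seq rho 0 ->
  is_lim_seq (halving x0 c rho) 0.
Proof.
intros Hx Hc Hr Hl.
assert (H0 : forall k, 0 <= halving x0 c rho k).
{ induction k as [|k IH]; simpl; [exact Hx|].
  assert (H := Rmult_le_pos _ _ Hc (Hr k)); lra. }
assert (Hcl : is_lim_seq (fun n => c * rho n) 0).
{ apply is_lim_seq_scal_0, Hl. }
apply is_lim_seq_spec; intros eps.
assert (He4 : 0 < eps / 4) by (generalize (cond_pos eps); lra).
destruct (proj2 (is_lim_seq_spec _ _) Hcl (mkposreal _ He4)) as [K HK]; simpl in HK.
set (X := halving x0 c rho K).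
(* Once c rho <= eps / 4, the recursion is dominated by x -> x / 2 + eps / 4, with fixed point eps /
   2 and ratio 1/2. *)
assert (Hi : forall i, halving x0 c rho (K + i) <= X * (1 / 2) ^ i + eps / 2).
{ induction i as [|i IH].
  - rewrite Nat.add_0_r; simpl; unfold X; lra.
  - replace (K + S i)%nat with (S (K + i)) by lia; simpl.
    assert (A := HK (K + i)%nat ltac:(lia)); rewrite Rminus_0_r in A.
    apply Rabs_def2 in A; lra. }
assert (Hg : is_lim_seq (fun i => X * (1 / 2) ^ i) 0).
{ apply is_lim_seq_scal_0, is_lim_seq_geom.
  rewrite Rabs_pos_eq; lra. }
assert (He2 : 0 < eps / 2) by lra.
destruct (proj2 (is_lim_seq_spec _ _) Hg (mkposreal _ He2)) as [I HI]; simpl in HI.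
exists (K + I)%nat; intros n Hn.
assert (A := HI (n - K)%nat ltac:(lia)); rewrite Rminus_0_r in A.
apply Rabs_def2 in A.
assert (B := Hi (n - K)%nat).
replace (K + (n - K))%nat with n in B by lia.
rewrite Rminus_0_r, Rabs_pos_eq by apply H0; lra.
Qed.

(* Picard iterates in which the series is cut off after finitely many terms, so
   that they depend on the kernel through finite algebraic expressions only. *)
Fixpoint picard (K : nat -> nat -> C) (k n : nat) : C :=
  match k with
  | O => 1%C
  | S i => (1 + csum (fun j => K n (S n + j)%nat * picard K i (S n + j)%nat) i)%C
  end.

Section Volterra.

Variables (K : nat -> nat -> C) (rho : nat -> R) (N0 : nat).
Hypothesis rho_pos : forall n, 0 <= rho n.
Hypothesis rho_dec : forall n, rho (S n) <= rho n.
Hypothesis rho_lim : is_lim_seq rho 0.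
Hypothesis rho_N0 : rho N0 <= 1 / 2.
Hypothesis HK : forall n j, (N0 <= n)%nat ->
  Cmod (K n (S n + j)%nat) <= rho (n + j)%nat - rho (S (n + j)).

Definition volterra_solution (u : nat -> C) : Prop :=
  forall n, (N0 <= n)%nat ->
    @is_series C_AbsRing C_NormedModule
      (fun j => K n (S n + j)%nat * u (S n + j)%nat)%C (u n - 1)%C.

Lemma rho_antitone (m n : nat) : (m <= n)%nat -> rho n <= rho m.
Proof.
induction 1; [lra|]. eapply Rle_trans; [apply rho_dec|assumption].
Qed.

Lemma kernel_mult_bound (u : nat -> C) (B : R) (n j : nat) :
  (N0 <= n)%nat -> (forall m, (N0 <= m)%nat -> Cmod (u m) <= B) ->
  Cmod (K n (S n + j)%nat * u (S n + j)%nat)%C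
  <= B * (rho (n + j)%nat - rho (S (n + j))).
Proof.
intros Hn HB; rewrite Cmod_mult, Rmult_comm.
apply Rmult_le_compat; try apply Cmod_ge_0; [apply HB; lia|apply HK, Hn].
Qed.

Lemma kernel_sum_half (u : nat -> C) (B : R) (n k : nat) :
  (N0 <= n)%nat -> 0 <= B -> (forall m, (N0 <= m)%nat -> Cmod (u m) <= B) ->
  Cmod (csum (fun j => K n (S n + j)%nat * u (S n + j)%nat)%C k) <= B / 2.
Proof.
intros Hn HB0 HB.
eapply Rle_trans.
- apply (csum_telescope_bound _ B rho n).
  intros j; apply kernel_mult_bound; assumption.
- assert (H1 := rho_antitone N0 n Hn). assert (H2 := rho_pos (n + S k)%nat).
  replace (B / 2) with (B * (1 / 2)) by field; apply Rmult_le_compat_l; lra.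
Qed.

(** The omitted terms start beyond index n + k >= k, which makes the truncation error uniform in
    n. *)
Lemma kernel_tail (u : nat -> C) (B : R) (n k i : nat) :
  (N0 <= n)%nat -> 0 <= B -> (forall m, (N0 <= m)%nat -> Cmod (u m) <= B) ->
  Cmod (csum (fun j => K n (S n + j)%nat * u (S n + j)%nat)%C (k + i)
        - csum (fun j => K n (S n + j)%nat * u (S n + j)%nat)%C k)%C <= B * rho k.
Proof.
intros Hn HB0 HB.
eapply Rle_trans.
- apply (csum_tail_bound _ B rho n).
  intros j; apply kernel_mult_bound; assumption.
- assert (H1 := rho_antitone k (n + S k) ltac:(lia)).
  assert (H2 := rho_pos (n + S k + i)%nat).
  apply Rmult_le_compat_l; lra.
Qed.

Lemma picard_bound (k n : nat) : (N0 <= n)%nat -> Cmod (picard K k n) <= 2.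
Proof.
revert n; induction k as [|k IH]; intros n Hn; simpl.
- rewrite Cmod_1; lra.
- eapply Rle_trans; [apply Cmod_triangle|]; rewrite Cmod_1.
  assert (H := kernel_sum_half (picard K k) 2 n k Hn ltac:(lra) IH); simpl in H; lra.
Qed.

Lemma csum_kernel_minus (u v : nat -> C) (n k : nat) :
  (csum (fun j => K n (S n + j)%nat * u (S n + j)%nat)%C k
   - csum (fun j => K n (S n + j)%nat * v (S n + j)%nat)%C k)%C
  = csum (fun j => K n (S n + j)%nat * (u (S n + j)%nat - v (S n + j)%nat))%C k.
Proof.
rewrite csum_minus; apply csum_ext; intros j; simpl; ring.
Qed.

Lemma halving_pos (x0 c : R) (k : nat) :
  0 <= x0 -> 0 <= c -> 0 <= halving x0 c rho k.
Proof.
intros Hx Hc; induction k as [|k IH]; simpl; [exact Hx|].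
assert (H := Rmult_le_pos _ _ Hc (rho_pos k)); lra.
Qed.

(** All iterates are bounded by 2. Hence the distance to the zeroth iterate 1 is at most 3, and
    cutting the sum at k costs at most 2 rho k. *)
Lemma picard_cauchy (k l n : nat) : (N0 <= n)%nat ->
  Cmod (picard K (k + l) n - picard K k n)%C <= halving 3 2 rho k.
Proof.
revert n; induction k as [|k IH]; intros n Hn.
- simpl; eapply Rle_trans; [apply Cmod_triangle|].
  rewrite Cmod_opp, Cmod_1; generalize (picard_bound l n Hn); lra.
- change (S k + l)%nat with (S (k + l)); cbn [picard halving].
  set (S1 := csum (fun j => K n (S n + j)%nat * picard K (k + l) (S n + j)%nat)%C).
  set (S2 := csum (fun j => K n (S n + j)%nat * picard K k (S n + j)%nat)%C).
  replace (1 + S1 (k + l)%nat - (1 + S2 k))%C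
    with ((S1 (k + l)%nat - S1 k) + (S1 k - S2 k))%C by ring.
  eapply Rle_trans; [apply Cmod_triangle|].
  rewrite Rplus_comm; apply Rplus_le_compat.
  + unfold S1, S2; rewrite (csum_kernel_minus (picard K (k + l)) (picard K k)).
    apply (kernel_sum_half (fun m => picard K (k + l) m - picard K k m)%C).
    * exact Hn.
    * apply halving_pos; lra.
    * exact IH.
  + apply (kernel_tail (picard K (k + l))); [exact Hn|lra|].
    intros m Hm; apply picard_bound, Hm.
Qed.

Lemma volterra_existence :
  exists v : nat -> C, volterra_solution v /\
    forall k n, (N0 <= n)%nat -> Cmod (v n - picard K k n)%C <= halving 3 2 rho k.
Proof.
assert (HD := halving_lim 3 2 rho ltac:(lra) ltac:(lra) rho_pos rho_lim).
assert (HE : forall n, exists L, (N0 <= n)%nat ->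
  forall k, Cmod (L - picard K k n)%C <= halving 3 2 rho k).
(* Below [N0] the sequence receives the default value 0. *)
{ intros n; destruct (le_dec N0 n) as [Hn|Hn]; [|exists 0%C; lia].
  destruct (C_cauchy_cv (fun k => picard K k n) (halving 3 2 rho) HD) as [L HL].
  - intros j k.
    assert (Pj := halving_pos 3 2 j ltac:(lra) ltac:(lra)).
    assert (Pk := halving_pos 3 2 k ltac:(lra) ltac:(lra)).
    destruct (le_dec j k) as [H|H].
    + generalize (picard_cauchy j (k - j) n Hn).
      replace (j + (k - j))%nat with k by lia; lra.
    + generalize (picard_cauchy k (j - k) n Hn).
      replace (k + (j - k))%nat with j by lia.
      replace (picard K k n - picard K j n)%C
        with (- (picard K j n - picard K k n))%C by ring.
      rewrite Cmod_opp; lra.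
  - exists L; intros _; exact HL. }
destruct (functional_choice _ HE) as [v Hv].
exists v; split; [|intros k n Hn; apply Hv, Hn].
intros n Hn; apply (clim_filterlim eventually).
intros eps Heps.
assert (He2 : 0 < eps / 2) by lra.
destruct (proj2 (is_lim_seq_spec _ _) HD (mkposreal _ He2)) as [N HN]; simpl in HN.
exists N; intros k Hk.
assert (H1 := HN k Hk). assert (H2 := HN (S k) ltac:(lia)).
rewrite Rminus_0_r in H1, H2; apply Rabs_def2 in H1; apply Rabs_def2 in H2.
assert (H3 := Hv n Hn (S k)); cbn [picard] in H3.
assert (H4 := kernel_sum_half (fun m => v m - picard K k m)%C (halving 3 2 rho k) n k
  Hn ltac:(apply halving_pos; lra) (fun m Hm => Hv m Hm k)); cbv beta in H4.
rewrite <- csum_kernel_minus in H4.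
set (S1 := csum (fun j => K n (S n + j)%nat * v (S n + j)%nat)%C k) in *.
set (S2 := csum (fun j => K n (S n + j)%nat * picard K k (S n + j)%nat)%C k) in *.
change (Cmod (S1 - (v n - 1))%C < eps).
(* Partial sums with [v] are compared with those of the k-th iterate, which form the next iterate up
   to the constant 1. *)
replace (S1 - (v n - 1))%C with ((S1 - S2) + - (v n - (1 + S2)))%C by ring.
eapply Rle_lt_trans; [apply Cmod_triangle|]; rewrite Cmod_opp; lra.
Qed.

Lemma series_remainder (u : nat -> C) (M : R) (n k : nat) :
  (N0 <= n)%nat -> 0 <= M -> (forall m, (N0 <= m)%nat -> Cmod (u m) <= M) ->
  volterra_solution u ->
  Cmod (u n - 1 - csum (fun j => K n (S n + j)%nat * u (S n + j)%nat)%C k)%C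
  <= M * rho k.
Proof.
intros Hn HM Hu Hs.
apply le_epsilon; intros eps Heps.
destruct (proj2 (clim_filterlim eventually _ _) (Hs n Hn) eps Heps) as [N HN].
assert (H1 := HN (k + N)%nat ltac:(lia)).
assert (H2 := kernel_tail u M n k N Hn HM Hu).
set (S1 := csum (fun j => K n (S n + j)%nat * u (S n + j)%nat)%C) in *.
change (Cmod (S1 (k + N)%nat - (u n - 1))%C < eps) in H1.
replace (u n - 1 - S1 k)%C
  with ((S1 (k + N)%nat - S1 k) + - (S1 (k + N)%nat - (u n - 1)))%C by ring.
eapply Rle_trans; [apply Cmod_triangle|]; rewrite Cmod_opp; lra.
Qed.

(** Every bounded solution is approximated by the same iterates, whatever its bound; this yields
    uniqueness. *)
Lemma solution_near_picard (u : nat -> C) (M : R) (k n : nat) :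
  (N0 <= n)%nat -> 0 <= M -> (forall m, (N0 <= m)%nat -> Cmod (u m) <= M) ->
  volterra_solution u ->
  Cmod (u n - picard K k n)%C <= halving (M + 1) M rho k.
Proof.
intros Hn HM Hu Hs; revert n Hn; induction k as [|k IH]; intros n Hn.
- simpl; eapply Rle_trans; [apply Cmod_triangle|].
  rewrite Cmod_opp, Cmod_1; generalize (Hu n Hn); lra.
- cbn [picard halving].
  assert (H1 := series_remainder u M n k Hn HM Hu Hs).
  assert (H2 := kernel_sum_half (fun m => u m - picard K k m)%C
    (halving (M + 1) M rho k) n k Hn ltac:(apply halving_pos; lra) IH); cbv beta in H2.
  rewrite <- csum_kernel_minus in H2.
  set (S1 := csum (fun j => K n (S n + j)%nat * u (S n + j)%nat)%C k) in *.
  set (S2 := csum (fun j => K n (S n + j)%nat * picard K k (S n + j)%nat)%C k) in *.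
  replace (u n - (1 + S2))%C with ((u n - 1 - S1) + (S1 - S2))%C by ring.
  eapply Rle_trans; [apply Cmod_triangle|lra].
Qed.

Lemma volterra_uniqueness (u v : nat -> C) (M M' : R) :
  (forall m, (N0 <= m)%nat -> Cmod (u m) <= M) -> volterra_solution u ->
  (forall m, (N0 <= m)%nat -> Cmod (v m) <= M') -> volterra_solution v ->
  forall n, (N0 <= n)%nat -> u n = v n.
Proof.
intros Hu Su Hv Sv n Hn.
assert (HM : 0 <= M) by (eapply Rle_trans; [apply Cmod_ge_0|apply (Hu n Hn)]).
assert (HM' : 0 <= M') by (eapply Rle_trans; [apply Cmod_ge_0|apply (Hv n Hn)]).
assert (HL : is_lim_seq
  (fun k => halving (M + 1) M rho k + halving (M' + 1) M' rho k) (0 + 0)).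
{ apply is_lim_seq_plus'; apply halving_lim; auto; lra. }
rewrite Rplus_0_l in HL.
assert (H : Cmod (u n - v n)%C <= 0).
{ apply le_of_le_add_vanishing with (B := 1) (e := fun k =>
    halving (M + 1) M rho k + halving (M' + 1) M' rho k); [exact HL|].
  intros k.
  replace (u n - v n)%C with ((u n - picard K k n) + - (v n - picard K k n))%C by ring.
  eapply Rle_trans; [apply Cmod_triangle|]; rewrite Cmod_opp.
  generalize (solution_near_picard u M k n Hn HM Hu Su)
    (solution_near_picard v M' k n Hn HM' Hv Sv); lra. }
assert (E : (u n - v n)%C = RtoC 0)
  by (apply Cmod_eq_0; generalize (Cmod_ge_0 (u n - v n)%C); lra).
replace (u n) with ((u n - v n) + v n)%C by ring; rewrite E; ring.
Qed.

(** The series at n is bounded by M rho n, because the kernel at n only uses decrements of [rho]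
    from index n on. *)
Lemma volterra_solution_lim (u : nat -> C) (M : R) :
  0 <= M -> (forall m, (N0 <= m)%nat -> Cmod (u m) <= M) -> volterra_solution u ->
  clim eventually u 1%C.
Proof.
intros HM Hu Hs eps Heps.
assert (HML : is_lim_seq (fun n => M * rho n) 0).
{ apply is_lim_seq_scal_0, rho_lim. }
destruct (proj2 (is_lim_seq_spec _ _) HML (mkposreal _ Heps)) as [N HN]; simpl in HN.
exists (N + N0)%nat; intros n Hn.
assert (H1 := HN n ltac:(lia)).
rewrite Rminus_0_r in H1; apply Rabs_def2 in H1.
apply Rle_lt_trans with (M * rho n); [|lra].
apply le_of_le_add_vanishing with (B := M) (e := rho); [exact rho_lim|].
intros k.
assert (H2 := series_remainder u M n k ltac:(lia) HM Hu Hs).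
assert (H3 : Cmod (csum (fun j => K n (S n + j)%nat * u (S n + j)%nat)%C k)
             <= M * rho n).
{ eapply Rle_trans.
  - apply (csum_telescope_bound _ M rho n).
    intros j; apply kernel_mult_bound; [lia|exact Hu].
  - apply Rmult_le_compat_l; [exact HM|].
    generalize (rho_pos (n + S k)%nat); lra. }
set (S1 := csum (fun j => K n (S n + j)%nat * u (S n + j)%nat)%C k) in *.
replace (u n - 1)%C with ((u n - 1 - S1) + S1)%C by ring.
eapply Rle_trans; [apply Cmod_triangle|lra].
Qed.

End Volterra.

Lemma C1_picard (D : C -> Prop) (K : C -> nat -> nat -> C) (N0 k n : nat) :
  (forall n m, (N0 <= n)%nat -> (n < m)%nat -> C1_on D (fun z => K z n m)) ->
  (N0 <= n)%nat -> C1_on D (fun z => picard (K z) k n).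
Proof.
intros HK; revert n; induction k as [|k IH]; intros n Hn; simpl.
- apply C1_const.
- apply C1_plus; [apply C1_const|].
  apply (C1_csum D (fun j z => K z n (S (n + j)) * picard (K z) k (S (n + j)))%C).
  intros j; apply C1_mult; [apply HK; lia|apply IH; lia].
Qed.

(** * Bounds for the kernel *)

Lemma Cprod_empty (x : nat -> C) (n m : nat) : (m < n)%nat -> Cprod_n_m x n m = 1%C.
Proof.
intros H; unfold Cprod_n_m, Iter.iter_nat.
replace (S m - n)%nat with 0%nat by lia; reflexivity.
Qed.

Lemma Cprod_head (x : nat -> C) (n m : nat) : (n <= m)%nat ->
  Cprod_n_m x n m = (x n * Cprod_n_m x (S n) m)%C.
Proof.
intros H; unfold Cprod_n_m.
rewrite (Iter.iter_nat_Chasles Cmult 1 Cmult_1_l Cmult_assoc x n n m) by lia.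
rewrite (Iter.iter_nat_point Cmult 1 Cmult_1_r); reflexivity.
Qed.

Lemma Cprod_last (x : nat -> C) (n m : nat) : (n <= S m)%nat ->
  Cprod_n_m x n (S m) = (Cprod_n_m x n m * x (S m))%C.
Proof.
intros H; unfold Cprod_n_m.
rewrite (Iter.iter_nat_Chasles Cmult 1 Cmult_1_l Cmult_assoc x n m (S m)) by lia.
rewrite (Iter.iter_nat_point Cmult 1 Cmult_1_r); reflexivity.
Qed.

Lemma Cprod_bound (x : nat -> C) (N0 n m : nat) :
  (forall i, (N0 <= i)%nat -> Cmod (x i) <= 1) -> (N0 <= n)%nat ->
  Cmod (Cprod_n_m x n m) <= 1.
Proof.
intros H Hn; destruct (le_lt_dec n m) as [Hm|Hm].
- replace m with (n + (m - n))%nat by lia.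
  induction (m - n)%nat as [|j IH].
  + rewrite Nat.add_0_r, Cprod_head, Cprod_empty, Cmult_1_r by lia; auto.
  + replace (n + S j)%nat with (S (n + j)) by lia.
    rewrite Cprod_last, Cmod_mult by lia.
    assert (H1 := H (S (n + j)) ltac:(lia)).
    assert (H2 := Cmod_ge_0 (x (S (n + j)))).
    assert (H3 := Cmod_ge_0 (Cprod_n_m x n (n + j))). nra.
- rewrite Cprod_empty by lia; rewrite Cmod_1; lra.
Qed.

Lemma C1_Cprod (D : C -> Prop) (x : C -> nat -> C) (N0 n m : nat) :
  (forall i, (N0 <= i)%nat -> C1_on D (fun z => x z i)) -> (N0 <= n)%nat ->
  C1_on D (fun z => Cprod_n_m (x z) n m).
Proof.
intros H Hn; destruct (le_lt_dec n m) as [Hm|Hm].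
- replace m with (n + (m - n))%nat by lia.
  induction (m - n)%nat as [|j IH].
  + apply C1_ext with (fun z => x z n); [|apply H, Hn].
    intros z _; rewrite Nat.add_0_r, Cprod_head, Cprod_empty by lia; ring.
  + apply C1_ext with (fun z => Cprod_n_m (x z) n (n + j) * x z (S (n + j)))%C.
    * intros z _; replace (n + S j)%nat with (S (n + j)) by lia.
      rewrite Cprod_last by lia; reflexivity.
    * apply C1_mult; [exact IH|apply H; lia].
- apply C1_ext with (fun _ => 1%C); [|apply C1_const].
  intros z _; rewrite Cprod_empty by lia; reflexivity.
Qed.

Section Jacobi.

Variables (am1 : R) (a b : nat -> R).
Hypothesis ham1 : 0 < am1.
Hypothesis ha : forall n, 0 < a n.

Lemma prev_pos (n : nat) : 0 < prev am1 a n.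
Proof. destruct n; simpl; auto. Qed.

Lemma kappa_pos (n : nat) : 0 < kappa a n.
Proof. apply sqrt_lt_R0, Rdiv_lt_0_compat; apply ha. Qed.

Lemma kappa_kk (n : nat) : kappa a n = kk am1 a (S n) * kappa a (S n).
Proof.
unfold kappa, kk; simpl prev.
assert (H0 := sqrt_lt_R0 _ (ha n)). assert (H1 := sqrt_lt_R0 _ (ha (S n))).
assert (H2 := sqrt_lt_R0 _ (ha (S (S n)))).
rewrite !sqrt_div_alt, sqrt_mult by (apply ha || apply Rlt_le, ha).
assert (E : a (S n) = sqrt (a (S n)) * sqrt (a (S n)))
  by (symmetry; apply sqrt_sqrt, Rlt_le, ha).
rewrite E at 2; field; lra.
Qed.

Lemma alpha_pos (n : nat) : 0 < alpha am1 a n.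
Proof.
apply Rdiv_lt_0_compat; [lra|].
apply Rmult_lt_0_compat; [lra|].
apply sqrt_lt_R0, Rmult_lt_0_compat; [apply prev_pos|apply ha].
Qed.

Variables (e : edge) (z : C) (N0 : nat).

Let zt := zeta_ am1 a b e z.
Let sg := Defs.sigma am1 a b e z.
Let P (p m : nat) : C := Cprod_n_m sg p m.

Lemma zeta__le_1 (n : nat) : Cmod (zt n) <= 1.
Proof. apply Cmod_zeta_le_1. Qed.

Lemma sigma_le_1 (n : nat) : Cmod (sg n) <= 1.
Proof.
unfold sg, Defs.sigma; rewrite Cmod_mult.
assert (H1 := zeta__le_1 n). assert (H2 := zeta__le_1 (pred n)).
assert (H3 := Cmod_ge_0 (zt n)). assert (H4 := Cmod_ge_0 (zt (pred n))).
unfold zt in *; nra.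
Qed.

(** * Kernel estimates from a lower bound for 1 - zeta zeta' and a summable variation *)

Section Bounds.

Variables (c Bz tot : R) (tl : nat -> R).
Hypothesis Hc : 0 < c.
Hypothesis Hcz : forall n m, (N0 <= n)%nat -> (N0 <= m)%nat ->
  c <= Cmod (1 - zt n * zt m)%C.
Hypothesis HBz : forall n, (N0 <= n)%nat -> Cmod (/ zt n) <= Bz.
Hypothesis Htl : forall n,
  Cmod (z_ am1 a b (S n) z - z_ am1 a b n z)%C
  + Cmod (z_ am1 a b (S (S n)) z - z_ am1 a b (S n) z)%C
  + Rabs (kk am1 a (S n) - 1) <= tl n - tl (S n).
Hypothesis Htot : forall n, 0 <= tl n <= tot.

Let nu (n : nat) : R := Cmod (z_ am1 a b (S n) z - z_ am1 a b n z)%C.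

Lemma zeta__lipschitz (n : nat) : (N0 <= n)%nat ->
  Cmod (zt (S n) - zt n)%C <= 2 / c * nu n.
Proof.
intros Hn.
assert (H := f_equal Cmod (zeta_sub e (z_ am1 a b n z) (z_ am1 a b (S n) z))).
rewrite !Cmod_mult, Cmod_opp, !Cmod_mult, Cmod_R, (Rabs_pos_eq 2) in H by lra.
change (zeta e (z_ am1 a b n z)) with (zt n) in H.
change (zeta e (z_ am1 a b (S n) z)) with (zt (S n)) in H.
fold (nu n) in H.
assert (H1 := zeta__le_1 n). assert (H2 := zeta__le_1 (S n)).
assert (H3 := Cmod_ge_0 (zt n)). assert (H4 := Cmod_ge_0 (zt (S n))).
assert (H5 := Hcz n (S n) Hn ltac:(lia)).
assert (H6 := Cmod_ge_0 (zt (S n) - zt n)%C).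
assert (Hnu : 0 <= nu n) by apply Cmod_ge_0.
apply Rmult_le_reg_r with c; [exact Hc|].
replace (2 / c * nu n * c) with (2 * nu n) by (field; lra).
apply Rle_trans with (Cmod (zt (S n) - zt n)%C * Cmod (1 - zt n * zt (S n))%C);
  [apply Rmult_le_compat_l; assumption|].
rewrite H; apply Rmult_le_compat_r; [exact Hnu|]. nra.
Qed.

(** The counterpart of dividing by the derivative of a phase in an oscillatory integral: a bounded
    weight, although products of [sg] need not decay. *)
Let cc (p : nat) : C := (sg p / (1 - sg p))%C.

Lemma one_sub_sigma_bound (p : nat) : (N0 < p)%nat -> c <= Cmod (1 - sg p)%C.
Proof. intros Hp; apply (Hcz p (pred p)); lia. Qed.

Lemma one_sub_sigma_neq_0 (p : nat) : (N0 < p)%nat -> (1 - sg p)%C <> RtoC 0.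
Proof.
intros Hp; apply Cmod_gt_0; generalize (one_sub_sigma_bound p Hp); lra.
Qed.

Lemma cc_bound (p : nat) : (N0 < p)%nat -> Cmod (cc p) <= / c.
Proof.
intros Hp; unfold cc; rewrite Cmod_div by (apply one_sub_sigma_neq_0, Hp).
assert (H1 := one_sub_sigma_bound p Hp). assert (H2 := sigma_le_1 p).
assert (H3 : / Cmod (1 - sg p)%C <= / c) by (apply Rinv_le_contravar; lra).
assert (H4 : 0 < / Cmod (1 - sg p)%C) by (apply Rinv_0_lt_compat; lra).
unfold Rdiv. assert (H5 := Cmod_ge_0 (sg p)).
replace (/ c) with (1 * / c) by ring; apply Rmult_le_compat; lra.
Qed.

(** Consecutive sigmas share a factor: sigma_(p+1) - sigma_(p+2) = - zeta_(p+1) (zeta_(p+2) -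
    zeta_p). The constant is 2 / c from the Lipschitz bound times 1 / c^2 from the two
    denominators. *)
Lemma cc_variation (p : nat) : (N0 <= p)%nat ->
  Cmod (cc (S p) - cc (S (S p)))%C <= 2 / (c * c * c) * (nu p + nu (S p)).
Proof.
intros Hp.
assert (N1 := one_sub_sigma_neq_0 (S p) ltac:(lia)).
assert (N2 := one_sub_sigma_neq_0 (S (S p)) ltac:(lia)).
assert (B1 := one_sub_sigma_bound (S p) ltac:(lia)).
assert (B2 := one_sub_sigma_bound (S (S p)) ltac:(lia)).
assert (E : (cc (S p) - cc (S (S p)))%C
  = (- (zt (S p) * ((zt (S (S p)) - zt (S p)) + (zt (S p) - zt p)))
     / ((1 - sg (S p)) * (1 - sg (S (S p)))))%C).
{ transitivity ((sg (S p) - sg (S (S p))) / ((1 - sg (S p)) * (1 - sg (S (S p)))))%C.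
  - unfold cc; field; split; assumption.
  - unfold Cdiv; f_equal; unfold sg, Defs.sigma; simpl pred; fold zt; ring. }
assert (N3 : ((1 - sg (S p)) * (1 - sg (S (S p))))%C <> RtoC 0)
  by (apply Cmult_neq_0; assumption).
rewrite E, Cmod_div, Cmod_opp, !Cmod_mult by exact N3.
assert (L1 := zeta__lipschitz p Hp). assert (L2 := zeta__lipschitz (S p) ltac:(lia)).
assert (T := Cmod_triangle (zt (S (S p)) - zt (S p))%C (zt (S p) - zt p)%C).
assert (Z1 := zeta__le_1 (S p)). assert (Z0 := Cmod_ge_0 (zt (S p))).
set (X := Cmod (zt (S (S p)) - zt (S p) + (zt (S p) - zt p))%C) in *.
assert (HX : 0 <= X) by apply Cmod_ge_0.
set (y1 := Cmod (1 - sg (S p))%C) in *. set (y2 := Cmod (1 - sg (S (S p)))%C) in *.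
assert (Hcc : 0 < c * c) by nra.
assert (Hy : / (y1 * y2) <= / (c * c)) by (apply Rinv_le_contravar; nra).
assert (Hy0 : 0 < / (y1 * y2)) by (apply Rinv_0_lt_compat; nra).
apply Rle_trans with ((2 / c * nu (S p) + 2 / c * nu p) * / (c * c)).
- unfold Rdiv at 1; apply Rmult_le_compat; try lra; nra.
- right; field; lra.
Qed.

Lemma tl_antitone (n m : nat) : (n <= m)%nat -> tl m <= tl n.
Proof.
induction 1 as [|m Hm IH]; [lra|].
generalize (Htl m) (Rabs_pos (kk am1 a (S m) - 1))
  (Cmod_ge_0 (z_ am1 a b (S m) z - z_ am1 a b m z)%C)
  (Cmod_ge_0 (z_ am1 a b (S (S m)) z - z_ am1 a b (S m) z)%C); lra.
Qed.

Lemma kk_tl (n : nat) : Rabs (kk am1 a (S n) - 1) <= tl n - tl (S n).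
Proof.
generalize (Htl n)
  (Cmod_ge_0 (z_ am1 a b (S n) z - z_ am1 a b n z)%C)
  (Cmod_ge_0 (z_ am1 a b (S (S n)) z - z_ am1 a b (S n) z)%C); lra.
Qed.

Lemma nu_tl (n : nat) : nu n + nu (S n) <= tl n - tl (S n).
Proof.
generalize (Htl n) (Rabs_pos (kk am1 a (S n) - 1)); unfold nu; lra.
Qed.

(** kappa_n / kappa_(n+j) is a product of factors k_i <= 1 + |k_i - 1| <= exp |k_i - 1|, and the
    exponents sum to at most [tot]. *)
Lemma kappa_ratio (n j : nat) : kappa a n <= exp tot * kappa a (n + j)%nat.
Proof.
assert (H : kappa a n <= exp (tl n - tl (n + j)%nat) * kappa a (n + j)%nat).
{ induction j as [|j IH].
  - rewrite Nat.add_0_r, Rminus_diag, exp_0; lra.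
  - eapply Rle_trans; [exact IH|].
    replace (n + S j)%nat with (S (n + j)) by lia.
    replace (tl n - tl (S (n + j)))
      with ((tl n - tl (n + j)%nat) + (tl (n + j)%nat - tl (S (n + j)))) by ring.
    rewrite exp_plus, Rmult_assoc.
    apply Rmult_le_compat_l; [apply Rlt_le, exp_pos|].
    rewrite kappa_kk at 1.
    apply Rmult_le_compat_r; [apply Rlt_le, kappa_pos|].
    eapply Rle_trans; [|apply exp_ineq1_le].
    generalize (kk_tl (n + j)) (Rle_abs (kk am1 a (S (n + j)) - 1)); lra. }
eapply Rle_trans; [exact H|].
apply Rmult_le_compat_r; [apply Rlt_le, kappa_pos|].
destruct (Rle_lt_or_eq_dec (tl n - tl (n + j)%nat) tot) as [Hlt|Heq].
- generalize (Htot n) (Htot (n + j)%nat); lra.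
- apply Rlt_le, exp_increasing, Hlt.
- rewrite Heq; lra.
Qed.

Let T (n m : nat) : C :=
  sum_n_m (fun p => RtoC (kappa a (pred p)) * P p m)%C (S n) m.
Let d (p : nat) : C := (RtoC (kappa a (pred p)) * cc p)%C.
Let C1 : R := / c + 2 / (c * c * c).

(** Writing kappa_p = k_(p+1) kappa_(p+1) extracts a common factor and leaves (k_(p+1) - 1) cc_(p+1)
    plus an increment of [cc]; these give the two terms of [C1]. *)
Lemma d_variation (p : nat) : (N0 <= p)%nat ->
  Cmod (d (S p) - d (S (S p)))%C <= kappa a (S p) * (C1 * (tl p - tl (S p))).
Proof.
intros Hp; unfold d; simpl pred.
assert (Hk := kappa_pos (S p)).
rewrite (kappa_kk p), RtoC_mult.
replace (RtoC (kk am1 a (S p)) * RtoC (kappa a (S p)) * cc (S p)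
         - RtoC (kappa a (S p)) * cc (S (S p)))%C
  with (RtoC (kappa a (S p)) * (RtoC (kk am1 a (S p) - 1) * cc (S p)
          + (cc (S p) - cc (S (S p)))))%C
  by (rewrite RtoC_minus; ring).
rewrite Cmod_mult, Cmod_R, Rabs_pos_eq by lra.
apply Rmult_le_compat_l; [lra|].
eapply Rle_trans; [apply Cmod_triangle|].
rewrite Cmod_mult, Cmod_R.
assert (H1 := cc_bound (S p) ltac:(lia)). assert (H2 := cc_variation p Hp).
assert (H3 := kk_tl p). assert (H4 := nu_tl p).
assert (H5 := Rabs_pos (kk am1 a (S p) - 1)). assert (H6 := Cmod_ge_0 (cc (S p))).
assert (H7 : 0 < 2 / (c * c * c)).
{ apply Rdiv_lt_0_compat; [lra|]; repeat apply Rmult_lt_0_compat; exact Hc. }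
unfold C1.
assert (Rabs (kk am1 a (S p) - 1) * Cmod (cc (S p)) <= (tl p - tl (S p)) * / c)
  by (apply Rmult_le_compat; assumption).
assert (2 / (c * c * c) * (nu p + nu (S p)) <= 2 / (c * c * c) * (tl p - tl (S p)))
  by (apply Rmult_le_compat_l; lra).
lra.
Qed.

(* Summation by parts: [P p m = cc p * (P (p + 1) m - P p m)], and [kappa * cc]
   has bounded variation. *)
Lemma T_add_boundary_bound (j n : nat) : (N0 <= n)%nat ->
  Cmod (T n (S (n + j)) + d (S n) * P (S n) (S (n + j)))%C
  <= kappa a (n + j)%nat * (/ c + exp tot * C1 * (tl n - tl (n + j)%nat)).
Proof.
revert n; induction j as [|j IH]; intros n Hn.
- rewrite Nat.add_0_r, Rminus_diag, Rmult_0_r, Rplus_0_r.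
  unfold T; rewrite sum_n_n; unfold P, d; simpl pred.
  rewrite Cprod_head, Cprod_empty by lia.
  assert (N1 := one_sub_sigma_neq_0 (S n) ltac:(lia)).
  replace (RtoC (kappa a n) * (sg (S n) * 1)
           + RtoC (kappa a n) * cc (S n) * (sg (S n) * 1))%C
    with (RtoC (kappa a n) * cc (S n))%C by (unfold cc; field; exact N1).
  assert (Hk := kappa_pos n).
  rewrite Cmod_mult, Cmod_R, Rabs_pos_eq by lra.
  apply Rmult_le_compat_l; [lra|apply cc_bound; lia].
- set (m := S (n + S j)).
  assert (Em : m = S (S n + j)) by (unfold m; lia).
  assert (HT : T n m = (RtoC (kappa a n) * P (S n) m + T (S n) m)%C).
  { unfold T; rewrite sum_Sn_m by (unfold m; lia); reflexivity. }
  assert (HP : P (S n) m = (sg (S n) * P (S (S n)) m)%C)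
    by (apply Cprod_head; unfold m; lia).
  assert (N1 := one_sub_sigma_neq_0 (S n) ltac:(lia)).
  (* With [m] fixed the lower end moves up by one. Since (1 + cc) sigma = cc, the lost summand and
     the boundary term merge into [d (S n) * P (S (S n)) m]. *)
  replace (T n m + d (S n) * P (S n) m)%C with
    ((T (S n) m + d (S (S n)) * P (S (S n)) m)
     + (d (S n) - d (S (S n))) * P (S (S n)) m)%C.
  + eapply Rle_trans; [apply Cmod_triangle|].
    rewrite Cmod_mult.
    assert (H1 := IH (S n) ltac:(lia)); rewrite <- Em in H1.
    assert (H2 := d_variation n Hn).
    assert (H3 : Cmod (P (S (S n)) m) <= 1).
    { apply (Cprod_bound sg 0); [intros; apply sigma_le_1|lia]. }
    assert (H4 := Cmod_ge_0 (P (S (S n)) m)).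
    assert (H5 := Cmod_ge_0 (d (S n) - d (S (S n)))%C).
    assert (H6 := kappa_ratio (S n) j).
    assert (HC1 : 0 < C1).
    { unfold C1; apply Rplus_lt_0_compat; [apply Rinv_0_lt_compat, Hc|].
      apply Rdiv_lt_0_compat; [lra|]; repeat apply Rmult_lt_0_compat; exact Hc. }
    assert (H7 : 0 <= C1 * (tl n - tl (S n))).
    { apply Rmult_le_pos; [lra|]. generalize (tl_antitone n (S n) ltac:(lia)); lra. }
    assert (H8 : kappa a (S n) * (C1 * (tl n - tl (S n)))
                 <= exp tot * kappa a (S n + j) * (C1 * (tl n - tl (S n))))
      by (apply Rmult_le_compat_r; assumption).
    replace (n + S j)%nat with (S n + j)%nat by lia.
    assert (H9 : Cmod (d (S n) - d (S (S n)))%C * Cmod (P (S (S n)) m)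
                 <= Cmod (d (S n) - d (S (S n)))%C) by nra.
    lra.
  + rewrite HT, HP; unfold d at 2 4; simpl pred; unfold cc; field; exact N1.
Qed.

(** [Bz] bounds 1 / zeta_m. In the bracket stand the upper boundary term, the interior variation and
    the lower boundary term of the summation by parts. The common factor kappa_(m-1) cancels against
    its inverse in [G]. *)
Definition kernel_const : R :=
  Bz * (/ c + exp tot * (/ c + 2 / (c * c * c)) * tot + exp tot * / c).

Lemma T_bound (n j : nat) : (N0 <= n)%nat ->
  Cmod (T n (S (n + j)))
  <= kappa a (n + j)%nat * (/ c + exp tot * C1 * tot + exp tot * / c).
Proof.
intros Hn.
assert (H1 := T_add_boundary_bound j n Hn).
assert (H3 : Cmod (P (S n) (S (n + j))) <= 1).
{ apply (Cprod_bound sg 0); [intros; apply sigma_le_1|lia]. }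
assert (H4 := Cmod_ge_0 (P (S n) (S (n + j)))).
assert (H5 := cc_bound (S n) ltac:(lia)).
assert (H6 := kappa_ratio n j). assert (Hk := kappa_pos n).
assert (Hkj := kappa_pos (n + j)).
assert (Hd : Cmod (d (S n)) <= exp tot * kappa a (n + j) * / c).
{ unfold d; simpl pred; rewrite Cmod_mult, Cmod_R, Rabs_pos_eq by lra.
  apply Rmult_le_compat; try apply Cmod_ge_0; lra. }
assert (HC1 : 0 < exp tot * C1).
{ apply Rmult_lt_0_compat; [apply exp_pos|].
  unfold C1; apply Rplus_lt_0_compat; [apply Rinv_0_lt_compat, Hc|].
  apply Rdiv_lt_0_compat; [lra|]; repeat apply Rmult_lt_0_compat; exact Hc. }
assert (H7 : exp tot * C1 * (tl n - tl (n + j)%nat) <= exp tot * C1 * tot).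
{ apply Rmult_le_compat_l; [lra|]. generalize (Htot n) (Htot (n + j)%nat); lra. }
replace (T n (S (n + j))) with
  ((T n (S (n + j)) + d (S n) * P (S n) (S (n + j)))
   + - (d (S n) * P (S n) (S (n + j))))%C by ring.
eapply Rle_trans; [apply Cmod_triangle|].
rewrite Cmod_opp, Cmod_mult.
assert (H8 : Cmod (d (S n)) * Cmod (P (S n) (S (n + j))) <= Cmod (d (S n)) * 1)
  by (apply Rmult_le_compat_l; [apply Cmod_ge_0|exact H3]).
assert (H9 : kappa a (n + j)%nat * (/ c + exp tot * C1 * (tl n - tl (n + j)%nat))
             <= kappa a (n + j)%nat * (/ c + exp tot * C1 * tot))
  by (apply Rmult_le_compat_l; lra).
lra.
Qed.

Lemma G_bound (n j : nat) : (N0 <= n)%nat ->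
  Cmod (G am1 a b e z n (S (n + j))) <= kernel_const.
Proof.
intros Hn.
change (G am1 a b e z n (S (n + j))) with
  (- (/ RtoC (kappa a (n + j)) * / zt (S (n + j)) * T n (S (n + j))))%C.
assert (Hk := kappa_pos (n + j)).
rewrite Cmod_opp, !Cmod_mult, <- RtoC_inv, Cmod_R by lra.
rewrite Rabs_pos_eq by (apply Rlt_le, Rinv_0_lt_compat; lra).
assert (H1 := HBz (S (n + j)) ltac:(lia)). assert (H2 := T_bound n j Hn).
assert (H3 := Cmod_ge_0 (/ zt (S (n + j)))%C).
assert (H4 := Cmod_ge_0 (T n (S (n + j)))).
set (X := / c + exp tot * C1 * tot + exp tot * / c) in *.
unfold kernel_const; fold C1; fold X.
replace (/ kappa a (n + j) * Cmod (/ zt (S (n + j))) * Cmod (T n (S (n + j))))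
  with (Cmod (/ zt (S (n + j))) * (/ kappa a (n + j) * Cmod (T n (S (n + j)))))
  by ring.
assert (H5 : / kappa a (n + j) * Cmod (T n (S (n + j))) <= X).
{ apply Rmult_le_reg_l with (kappa a (n + j)); [exact Hk|].
  replace (kappa a (n + j) * (/ kappa a (n + j) * Cmod (T n (S (n + j)))))
    with (Cmod (T n (S (n + j)))) by (field; lra).
  exact H2. }
apply Rmult_le_compat; try assumption.
apply Rmult_le_pos; [apply Rlt_le, Rinv_0_lt_compat|]; assumption.
Qed.

(** The difference of reciprocals is -2 (z_m - z_(m-1)) + (zeta_m - zeta_(m-1)), contributing 2 and
    2 / c; the remaining 1 comes from k_m - 1. *)
Lemma r_bound (n : nat) : (N0 <= n)%nat ->
  Cmod (r am1 a b e z (S n)) <= (3 + 2 / c) * (tl n - tl (S n)).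
Proof.
intros Hn.
replace (r am1 a b e z (S n)) with
  (- RtoC 2 * (z_ am1 a b (S n) z - z_ am1 a b n z) + (zt (S n) - zt n)
   + RtoC (kk am1 a (S n) - 1) * zt (S n))%C.
- eapply Rle_trans; [apply Cmod_triangle|].
  eapply Rle_trans; [apply Rplus_le_compat_r, Cmod_triangle|].
  rewrite !Cmod_mult, Cmod_opp, !Cmod_R, (Rabs_pos_eq 2) by lra.
  fold (nu n).
  assert (H1 := zeta__lipschitz n Hn). assert (H2 := kk_tl n).
  assert (H3 := nu_tl n). assert (H4 : 0 <= nu (S n)) by apply Cmod_ge_0.
  assert (H5 := zeta__le_1 (S n)). assert (H6 := Rabs_pos (kk am1 a (S n) - 1)).
  assert (H7 : 0 < 2 / c) by (apply Rdiv_lt_0_compat; lra).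
  assert (H8 := Cmod_ge_0 (zt (S n))). nra.
- unfold r; simpl pred.
  change (zeta_ am1 a b e z n) with (zeta e (z_ am1 a b n z)).
  change (zeta_ am1 a b e z (S n)) with (zeta e (z_ am1 a b (S n) z)).
  rewrite !Cinv_zeta; unfold zt, zeta_; ring.
Qed.

Lemma kernel_bound (n j : nat) : (N0 <= n)%nat ->
  Cmod (G am1 a b e z n (S (n + j)) * r am1 a b e z (S (n + j)))%C
  <= kernel_const * (3 + 2 / c) * (tl (n + j)%nat - tl (S (n + j))).
Proof.
intros Hn; rewrite Cmod_mult, Rmult_assoc.
apply Rmult_le_compat; try apply Cmod_ge_0; [apply G_bound, Hn|apply r_bound; lia].
Qed.

End Bounds.

End Jacobi.

(** * Regularity in z *)

Lemma C1_sum_n_m (D : C -> Prop) (x : C -> nat -> C) (N0 n m : nat) :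
  (forall i, (N0 <= i)%nat -> C1_on D (fun z => x z i)) -> (N0 <= n)%nat ->
  C1_on D (fun z => sum_n_m (x z) n m).
Proof.
intros H Hn; destruct (le_lt_dec n m) as [Hm|Hm].
- replace m with (n + (m - n))%nat by lia.
  induction (m - n)%nat as [|j IH].
  + apply C1_ext with (fun z => x z n); [|apply H, Hn].
    intros z _; rewrite Nat.add_0_r, sum_n_n; reflexivity.
  + apply C1_ext with (fun z => sum_n_m (x z) n (n + j) + x z (S (n + j)))%C.
    * intros z _; replace (n + S j)%nat with (S (n + j)) by lia.
      rewrite sum_n_Sm by lia; reflexivity.
    * apply C1_plus; [exact IH|apply H; lia].
- apply C1_ext with (fun _ => 0%C); [|apply C1_const].
  intros z _; rewrite sum_n_m_zero by lia; reflexivity.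
Qed.

Section Regularity.

Variables (am1 : R) (a b : nat -> R) (e : edge) (N0 : nat) (D : C -> Prop) (c : R).
Hypothesis Hc : 0 < c.
Hypothesis Hcz : forall n z w, (N0 <= n)%nat -> D z -> D w ->
  c <= Cmod (1 - zeta_ am1 a b e z n * zeta_ am1 a b e w n)%C.

(** The slope is -2 alpha zeta zeta' / (1 - zeta zeta'), explicit in the values of zeta and bounded
    by 2 alpha / c. Boundedness makes zeta Lipschitz on [D], and continuity of zeta then makes the
    slope continuous. *)
Lemma C1_zeta_ (n : nat) :
  (N0 <= n)%nat -> C1_on D (fun z => zeta_ am1 a b e z n).
Proof.
intros Hn.
set (f := fun z => zeta_ am1 a b e z n).
set (A := RtoC (alpha am1 a n)).
assert (H0 : forall z w, D z -> D w -> (1 - f z * f w)%C <> RtoC 0).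
{ intros z w Dz Dw; apply Cmod_gt_0; generalize (Hcz n z w Hn Dz Dw); unfold f; lra. }
assert (Hs : forall z w, D z -> D w ->
  (f w - f z = - (RtoC 2 * A) * (f z * f w) * / (1 - f z * f w) * (w - z))%C).
{ intros z w Dz Dw.
  assert (E := zeta_sub e (z_ am1 a b n z) (z_ am1 a b n w)).
  change (zeta e (z_ am1 a b n z)) with (f z) in E.
  change (zeta e (z_ am1 a b n w)) with (f w) in E.
  replace (f w - f z)%C with ((f w - f z) * (1 - f z * f w) * / (1 - f z * f w))%C
    by (field; apply H0; assumption).
  rewrite E; unfold z_, A; ring. }
assert (Hf1 : forall z, Cmod (f z) <= 1) by (intros z; apply Cmod_zeta_le_1).
assert (Hcont : forall z w, D z -> D w -> clim (near2 D z w) (fun p => f (snd p)) (f w)).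
{ intros z w Dz Dw.
  apply clim_ext with (fun p =>
    (snd p - w) * (- (RtoC 2 * A) * (f w * f (snd p)) * / (1 - f w * f (snd p))) + f w)%C.
  { exists 1; split; [lra|]; intros z' w' _ Dw' _ _; simpl.
    rewrite Cmult_comm, <- Hs by assumption; ring. }
  assert (K : clim (near2 D z w) (fun p => (snd p - w) *
    (- (RtoC 2 * A) * (f w * f (snd p)) * / (1 - f w * f (snd p))))%C 0%C).
  { apply clim_mult_0 with (2 * Cmod A * / c).
    - intros eps He; exists eps; split; [assumption|].
      intros z' w' _ _ _ Hw; simpl.
      replace (w' - w - 0)%C with (w' - w)%C by ring; exact Hw.
    - exists 1; split; [lra|]; intros z' w' _ Dw' _ _; simpl.
      rewrite !Cmod_mult, Cmod_opp, !Cmod_mult, Cmod_R, (Rabs_pos_eq 2),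
        Cmod_inv by (lra || apply H0; assumption).
      assert (H1 := Hcz n w w' Hn Dw Dw'). fold (f w) (f w') in H1.
      assert (H2 : / Cmod (1 - f w * f w')%C <= / c) by (apply Rinv_le_contravar; lra).
      assert (H3 : 0 < / Cmod (1 - f w * f w')%C) by (apply Rinv_0_lt_compat; lra).
      assert (H4 := Hf1 w). assert (H5 := Hf1 w').
      assert (H6 := Cmod_ge_0 (f w)). assert (H7 := Cmod_ge_0 (f w')).
      assert (H8 := Cmod_ge_0 A).
      assert (H9 : 0 <= Cmod (f w) * Cmod (f w') <= 1) by nra.
      apply Rmult_le_compat; try lra.
      + apply Rmult_le_pos; lra.
      + rewrite <- (Rmult_1_r (2 * Cmod A)) at 2; apply Rmult_le_compat_l; lra. }
  assert (K' := clim_plus _ _ _ _ K (clim_const (F := near2 D z w) (f w))).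
  replace (0 + f w)%C with (f w) in K' by ring; exact K'. }
exists (fun z w => - (RtoC 2 * A) * (f z * f w) * / (1 - f z * f w))%C.
split; [exact Hs|].
intros z w Dz Dw.
assert (Hfst : clim (near2 D z w) (fun p => f (fst p)) (f z))
  by (apply near2_swap; simpl; apply Hcont; assumption).
assert (Hsnd := Hcont z w Dz Dw).
assert (Hprod := clim_mult _ _ _ _ Hfst Hsnd).
apply clim_mult; [apply clim_mult; [apply clim_const|exact Hprod]|].
apply clim_inv; [apply H0; assumption|].
apply clim_ext with (fun p => 1 + - RtoC 1 * (f (fst p) * f (snd p)))%C.
{ apply filter_forall; intros; ring. }
replace (1 - f z * f w)%C with (1 + - RtoC 1 * (f z * f w))%C by ring.
apply clim_plus; [apply clim_const|apply clim_mult; [apply clim_const|exact Hprod]].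
Qed.

Lemma C1_Cinv_zeta_ (n : nat) :
  (N0 <= n)%nat -> C1_on D (fun z => / zeta_ am1 a b e z n)%C.
Proof.
intros Hn; apply C1_inv; [intros; apply zeta_neq_0|apply C1_zeta_, Hn].
Qed.

Lemma C1_kernel (n m : nat) : (N0 <= n)%nat -> (n < m)%nat ->
  C1_on D (fun z => G am1 a b e z n m * r am1 a b e z m)%C.
Proof.
intros Hn Hm; apply C1_mult.
- unfold G; apply C1_opp, C1_mult.
  + apply C1_mult; [apply C1_const|apply C1_Cinv_zeta_; lia].
  + apply (C1_sum_n_m D (fun z p => RtoC (kappa a (pred p))
             * Cprod_n_m (Defs.sigma am1 a b e z) p m)%C (S N0)); [|lia].
    intros p Hp; apply C1_mult; [apply C1_const|].
    apply (C1_Cprod D (fun z => Defs.sigma am1 a b e z) (S N0)); [|lia].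
    intros i Hi; unfold Defs.sigma; apply C1_mult; apply C1_zeta_; lia.
- unfold r; apply C1_plus; [apply C1_minus; apply C1_Cinv_zeta_; lia|].
  apply C1_mult; [apply C1_const|apply C1_zeta_; lia].
Qed.

Lemma C1_q (n : nat) : C1_on D (fun z => q am1 a b N0 e z n).
Proof.
unfold q; apply (C1_Cprod D (fun z => zeta_ am1 a b e z) N0); [|lia].
intros i Hi; apply C1_zeta_, Hi.
Qed.

Lemma extend_down_C1_limit (f : C -> nat -> C) :
  C1_limit_on D (fun z => f z N0) -> C1_limit_on D (fun z => f z (S N0)) ->
  forall j, C1_limit_on D (fun z => fst (extend_down am1 a b z N0 (f z) j)) /\
            C1_limit_on D (fun z => snd (extend_down am1 a b z N0 (f z) j)).
Proof.
intros H1 H2; induction j as [|j [IH1 IH2]]; [split; assumption|].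
split.
- set (n := (N0 - j)%nat).
  apply C1_limit_ext with (fun z =>
    ((z - RtoC (b n)) * / RtoC (prev am1 a n)) * fst (extend_down am1 a b z N0 (f z) j)
    + (- (RtoC (a n) * / RtoC (prev am1 a n)))
      * snd (extend_down am1 a b z N0 (f z) j))%C.
  + intros z _; simpl; destruct (extend_down am1 a b z N0 (f z) j) as [x y]; simpl.
    unfold n, Cdiv; ring.
  + apply C1_limit_plus; apply C1_mult_limit; try assumption.
    * apply C1_mult; [|apply C1_const].
      apply C1_minus; [apply C1_id|apply C1_const].
    * apply C1_const.
- apply C1_limit_ext with (fun z => fst (extend_down am1 a b z N0 (f z) j)); [|assumption].
  intros z _; simpl; destruct (extend_down am1 a b z N0 (f z) j); reflexivity.
Qed.

Lemma jost_C1_limit (u : C -> nat -> C) :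
  (forall n, (N0 <= n)%nat -> C1_limit_on D (fun z => u z n)) ->
  forall n : Z, C1_limit_on D (fun z => jost am1 a b N0 e u z n).
Proof.
intros Hu.
assert (Ht : forall n, (N0 <= n)%nat ->
  C1_limit_on D (fun z => jost_tail am1 a b N0 e z (u z) n)).
{ intros n Hn; apply C1_mult_limit; [|apply Hu, Hn].
  apply C1_mult; [apply C1_const|apply C1_q]. }
intros n; unfold jost; destruct (Z_le_dec (Z.of_nat N0) n) as [H|H].
- apply Ht; lia.
- apply (extend_down_C1_limit (fun z => jost_tail am1 a b N0 e z (u z))); apply Ht; lia.
Qed.

End Regularity.

(** * The Jacobi equation *)

Section Recurrence.

Variables (am1 : R) (a b : nat -> R).
Hypothesis ham1 : 0 < am1.
Hypothesis ha : forall n, 0 < a n.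
Variables (e : edge) (z : C) (N0 : nat) (u : nat -> C).
Hypothesis Hu : volterra am1 a b N0 e z u.

Let zt := zeta_ am1 a b e z.
Let sg := Defs.sigma am1 a b e z.
Let rr := r am1 a b e z.
Let GG := G am1 a b e z.

(** The one summand of [G] that is lost when its first index rises from n to n + 1. *)
Let E (n m : nat) : C :=
  (/ RtoC (kappa a (pred m)) * / zt m * (RtoC (kappa a n) * Cprod_n_m sg (S n) m))%C.

Lemma G_step (n m : nat) : (n < m)%nat -> (GG (S n) m - GG n m)%C = E n m.
Proof.
intros H; unfold GG, G, E.
rewrite (sum_Sn_m _ (S n) m) by lia; unfold plus; simpl.
fold sg zt; ring.
Qed.

(** The empty sum lets [G_step] cover m = n + 1 as well, a pair that the Volterra series at n + 1
    does not contain. *)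
Lemma G_diag (n : nat) : GG n n = 0%C.
Proof.
unfold GG, G; rewrite sum_n_m_zero by lia; unfold zero; simpl; ring.
Qed.

Lemma RtoC_kappa_neq_0 (n : nat) : RtoC (kappa a n) <> RtoC 0.
Proof.
intros H; injection H; generalize (kappa_pos a ha n); lra.
Qed.

Lemma E_diag (n : nat) : E n (S n) = zt n.
Proof.
unfold E; simpl pred; rewrite Cprod_head, Cprod_empty by lia.
unfold sg, Defs.sigma; simpl pred; fold zt.
field; split; [apply zeta_neq_0|apply RtoC_kappa_neq_0].
Qed.

(** The increments depend on n through a factor common to all m; this turns the Volterra equation
    into a first-order recurrence for the differences of u. *)
Lemma E_step (n m : nat) : (S n < m)%nat ->
  E n m = (RtoC (kk am1 a (S n)) * sg (S n) * E (S n) m)%C.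
Proof.
intros H; unfold E; rewrite (Cprod_head _ (S n) m) by lia.
rewrite (kappa_kk am1 a ha n), RtoC_mult; ring.
Qed.

Lemma csum_shift (x : nat -> C) (k : nat) :
  csum x (S k) = (x 0%nat + csum (fun j => x (S j)) k)%C.
Proof.
induction k as [|k IH].
- rewrite csum_S, !csum_0; reflexivity.
- rewrite csum_S, IH, (csum_S (fun j => x (S j))); ring.
Qed.

Lemma csum_scal (w : C) (x : nat -> C) (k : nat) :
  csum (fun j => w * x j)%C k = (w * csum x k)%C.
Proof.
induction k as [|k IH]; [rewrite !csum_0; reflexivity|].
rewrite !csum_S, IH; ring.
Qed.

Lemma clim_shift (x : nat -> C) (l : C) :
  clim eventually x l -> clim eventually (fun k => x (S k)) l.
Proof.
intros H eps He; destruct (H eps He) as [N HN].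
exists N; intros k Hk; apply HN; lia.
Qed.

Lemma clim_unique (x : nat -> C) (l m : C) :
  clim eventually x l -> clim eventually x m -> l = m.
Proof.
intros Hl Hm.
exact (@filterlim_locally_unique nat C_AbsRing C_NormedModule eventually _ x l m
  (proj1 (clim_filterlim _ _ _) Hl) (proj1 (clim_filterlim _ _ _) Hm)).
Qed.

Lemma difference_series (n : nat) : (N0 <= n)%nat ->
  clim eventually (csum (fun j => E n (S n + j)%nat * rr (S n + j)%nat * u (S n + j)%nat)%C)
    (u (S n) - u n)%C.
Proof.
intros Hn.
set (x := fun j => (GG n (S n + j)%nat * rr (S n + j)%nat * u (S n + j)%nat)%C).
set (y := fun j => (GG (S n) (S (S n) + j)%nat * rr (S (S n) + j)%nat
                    * u (S (S n) + j)%nat)%C).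
assert (Hx : clim eventually (csum x) (u n - 1)%C)
  by (apply (clim_filterlim eventually), (Hu n Hn)).
assert (Hy : clim eventually (csum y) (u (S n) - 1)%C)
  by (apply (clim_filterlim eventually), (Hu (S n)); lia).
set (t := fun j => (E n (S n + j)%nat * rr (S n + j)%nat * u (S n + j)%nat)%C).
(* The term m = n + 1 belongs to the series at n alone, so the two series are aligned with a shift
   by one. *)
assert (Hxt : x 0%nat = (- t 0%nat)%C).
{ unfold x, t; rewrite Nat.add_0_r, <- (G_step n (S n)), G_diag by lia; ring. }
assert (Hst : forall k, csum t (S k) = (csum y k + - RtoC 1 * csum x (S k))%C).
{ intros k; rewrite !csum_shift, Hxt.
  replace (csum (fun j => t (S j)) k)
    with (csum y k - csum (fun j => x (S j)) k)%C; [ring|].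
  rewrite csum_minus; apply csum_ext; intros j.
  unfold x, y, t; rewrite <- (G_step n (S n + S j)) by lia.
  replace (S (S n) + j)%nat with (S n + S j)%nat by lia; ring. }
intros eps He.
assert (HL : clim eventually (fun k => csum y k + - RtoC 1 * csum x (S k))%C
               ((u (S n) - 1) + - RtoC 1 * (u n - 1))%C).
{ apply clim_plus; [exact Hy|apply clim_mult; [apply clim_const|]].
  apply (clim_shift (csum x)), Hx. }
destruct (HL eps He) as [N HN]; exists (S N); intros k Hk.
destruct k as [|k]; [lia|].
rewrite Hst; assert (H1 := HN k ltac:(lia)).
replace (u (S n) - u n)%C with (u (S n) - 1 + - RtoC 1 * (u n - 1))%C by ring.
exact H1.
Qed.

(** By [E_step] all terms of the difference series at n except m = n + 1 add up to k_(n+1)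
    sigma_(n+1) times the difference series at n + 1. *)
Lemma difference_recurrence (n : nat) : (N0 <= n)%nat ->
  (u (S n) - u n = zt n * rr (S n) * u (S n)
     + RtoC (kk am1 a (S n)) * sg (S n) * (u (S (S n)) - u (S n)))%C.
Proof.
intros Hn.
assert (H1 := difference_series n Hn).
assert (H2 := difference_series (S n) ltac:(lia)).
set (t := fun j => (E n (S n + j)%nat * rr (S n + j)%nat * u (S n + j)%nat)%C) in *.
set (t' := fun j => (E (S n) (S (S n) + j)%nat * rr (S (S n) + j)%nat
                     * u (S (S n) + j)%nat)%C) in *.
set (w := (RtoC (kk am1 a (S n)) * sg (S n))%C) in *.
apply (clim_unique (fun k => csum t (S k))); [apply (clim_shift (csum t)), H1|].
apply clim_ext with (fun k => zt n * rr (S n) * u (S n) + w * csum t' k)%C.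
- apply filter_forall; intros k; rewrite csum_shift, <- csum_scal; f_equal.
  + unfold t; rewrite Nat.add_0_r, E_diag; ring.
  + apply csum_ext; intros j; unfold t, t'.
    replace (S (S n) + j)%nat with (S n + S j)%nat by lia.
    rewrite (E_step n (S n + S j)) by lia; unfold w; ring.
- apply clim_plus; [apply clim_const|apply clim_mult; [apply clim_const|exact H2]].
Qed.

Lemma q_S (n : nat) : (1 <= N0 <= n)%nat ->
  q am1 a b N0 e z (S n) = (q am1 a b N0 e z n * zt n)%C.
Proof.
intros [H1 Hn]; destruct n as [|n]; [lia|].
unfold q; simpl pred; apply Cprod_last; lia.
Qed.

Lemma two_z_ (n : nat) :
  (RtoC 2 * z_ am1 a b n z
   = (z - RtoC (b n)) * / (RtoC (sqrt (prev am1 a n)) * RtoC (sqrt (a n))))%C.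
Proof.
assert (Hp := prev_pos am1 a ham1 ha n). assert (Hn := ha n).
assert (H1 := sqrt_lt_R0 _ Hp). assert (H2 := sqrt_lt_R0 _ Hn).
unfold z_, alpha, beta.
rewrite sqrt_mult by lra.
set (A := sqrt (prev am1 a n)) in *; set (B := sqrt (a n)) in *.
rewrite <- RtoC_mult, <- RtoC_inv by nra.
replace (1 / (2 * (A * B))) with (/ 2 * / (A * B)) by (field; lra).
replace (- (b n / (2 * (A * B)))) with (/ 2 * (- b n * / (A * B))) by (field; lra).
rewrite !RtoC_mult, RtoC_opp, (RtoC_inv 2) by lra.
field; intros E0; injection E0; lra.
Qed.

Lemma jost_tail_recurrence (n : nat) : (1 <= N0 <= n)%nat ->
  (RtoC (a n) * jost_tail am1 a b N0 e z u n
   + RtoC (b (S n)) * jost_tail am1 a b N0 e z u (S n)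
   + RtoC (a (S n)) * jost_tail am1 a b N0 e z u (S (S n))
   = z * jost_tail am1 a b N0 e z u (S n))%C.
Proof.
intros Hn; unfold jost_tail.
rewrite (q_S (S n)), (q_S n) by lia.
assert (HD := difference_recurrence n ltac:(lia)).
assert (HZ := two_z_ (S n)); simpl prev in HZ.
assert (HI := Cinv_zeta e (z_ am1 a b (S n) z)).
change (zeta e (z_ am1 a b (S n) z)) with (zt (S n)) in HI.
rewrite HZ in HI.
unfold rr, r, sg, Defs.sigma in HD; simpl pred in HD; fold zt in HD.
assert (Z0 : zt n <> RtoC 0) by apply zeta_neq_0.
assert (Z1 : zt (S n) <> RtoC 0) by apply zeta_neq_0.
assert (P0 := sqrt_lt_R0 _ (ha n)). assert (P1 := sqrt_lt_R0 _ (ha (S n))).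
assert (P2 := sqrt_lt_R0 _ (ha (S (S n)))).
assert (E0 : RtoC (a n) = (RtoC (sqrt (a n)) * RtoC (sqrt (a n)))%C)
  by (rewrite <- RtoC_mult, sqrt_sqrt by apply Rlt_le, ha; reflexivity).
assert (E1 : RtoC (a (S n)) = (RtoC (sqrt (a (S n))) * RtoC (sqrt (a (S n))))%C)
  by (rewrite <- RtoC_mult, sqrt_sqrt by apply Rlt_le, ha; reflexivity).
assert (Ek : RtoC (kk am1 a (S n)) = (RtoC (sqrt (a (S n))) * RtoC (sqrt (a (S n)))
  * / (RtoC (sqrt (a n)) * RtoC (sqrt (a (S (S n))))))%C).
{ rewrite <- E1; unfold kk; simpl prev.
  rewrite sqrt_mult, RtoC_div, RtoC_mult by (apply Rlt_le, ha || nra); reflexivity. }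
rewrite RtoC_minus, Ek in HD.
rewrite !RtoC_inv, E0, E1 by lra.
assert (R0 : RtoC (sqrt (a n)) <> RtoC 0) by (intros X; injection X; lra).
assert (R1 : RtoC (sqrt (a (S n))) <> RtoC 0) by (intros X; injection X; lra).
assert (R2 : RtoC (sqrt (a (S (S n)))) <> RtoC 0) by (intros X; injection X; lra).
set (A := RtoC (sqrt (a n))) in *. set (B := RtoC (sqrt (a (S n)))) in *.
set (X := RtoC (sqrt (a (S (S n))))) in *.
assert (HI' : (z - RtoC (b (S n)) = (/ zt (S n) + zt (S n)) * (A * B))%C)
  by (rewrite HI; field; split; assumption).
(* Here the form of r pays off: the coefficient of u_(n+1) collapses to zeta_n (1 / zeta_(n+1) +
   zeta_(n+1)) = 2 zeta_n z_(n+1). *)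
assert (HD' : (u n = zt n * (/ zt (S n) + zt (S n)) * u (S n)
  - B * B * / (A * X) * zt n * zt (S n) * u (S (S n)))%C).
{ transitivity (u (S n) - (u (S n) - u n))%C; [ring|].
  rewrite HD; field; repeat split; assumption. }
rewrite HD'.
transitivity ((RtoC (b (S n)) + (/ zt (S n) + zt (S n)) * (A * B))
  * (/ B * (q am1 a b N0 e z n * zt n) * u (S n)))%C.
- field; repeat split; assumption.
- rewrite <- HI'; ring.
Qed.

Lemma snd_extend_down (f : nat -> C) (j : nat) :
  snd (extend_down am1 a b z N0 f (S j)) = fst (extend_down am1 a b z N0 f j).
Proof. simpl; destruct (extend_down am1 a b z N0 f j); reflexivity. Qed.

End Recurrence.

(** * Extension below [N0] *)

Section JostJacobi.

Variables (am1 : R) (a b : nat -> R).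
Hypothesis ham1 : 0 < am1.
Hypothesis ha : forall n, 0 < a n.
Variables (e : edge) (z : C) (N0 : nat) (u : C -> nat -> C).
Hypothesis HN0 : (1 <= N0)%nat.
Hypothesis Hu : volterra am1 a b N0 e z (u z).

Let f := jost am1 a b N0 e u z.
Let ft := jost_tail am1 a b N0 e z (u z).

Lemma jost_ge (n : nat) : (N0 <= n)%nat -> f (Z.of_nat n) = ft n.
Proof.
intros H; unfold f, jost.
destruct (Z_le_dec (Z.of_nat N0) (Z.of_nat n)); [|lia].
rewrite Nat2Z.id; reflexivity.
Qed.

Lemma jost_le (j : nat) :
  f (Z.of_nat N0 - Z.of_nat j)%Z = fst (extend_down am1 a b z N0 ft j).
Proof.
unfold f, jost; fold ft.
destruct (Z_le_dec (Z.of_nat N0) (Z.of_nat N0 - Z.of_nat j)) as [H|H].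
- replace j with 0%nat by lia; simpl; f_equal; lia.
- do 2 f_equal; lia.
Qed.

Lemma jost_jacobi : jacobi_equation am1 a b z f.
Proof.
(* For n <= N0, including n = N0, the equation is the one that defined f_(n-1); for n > N0 all three
   indices lie in the tail. *)
intros n; destruct (le_lt_dec n N0) as [Hn|Hn].
- set (j := (N0 - n)%nat).
  replace (Z.of_nat n - 1)%Z with (Z.of_nat N0 - Z.of_nat (S j))%Z by lia.
  replace (Z.of_nat n) with (Z.of_nat N0 - Z.of_nat j)%Z by lia.
  assert (E : f (Z.of_nat N0 - Z.of_nat j + 1)%Z
              = snd (extend_down am1 a b z N0 ft j)).
  (* At j = 0 the upper neighbour f_(N0+1) still belongs to the tail; later it is the value found
     one step earlier. *)
  { destruct j as [|i].
    - replace (Z.of_nat N0 - Z.of_nat 0 + 1)%Z with (Z.of_nat (S N0)) by lia.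
      apply jost_ge; lia.
    - rewrite snd_extend_down, <- jost_le; f_equal; lia. }
  rewrite E, !jost_le; simpl.
  destruct (extend_down am1 a b z N0 ft j) as [x y]; simpl.
  replace (N0 - j)%nat with n by (unfold j; lia).
  field; intros X; injection X; generalize (prev_pos am1 a ham1 ha n); lra.
- destruct n as [|n]; [lia|].
  replace (Z.of_nat (S n) - 1)%Z with (Z.of_nat n) by lia.
  replace (Z.of_nat (S n) + 1)%Z with (Z.of_nat (S (S n))) by lia.
  rewrite !jost_ge by lia; simpl prev.
  apply jost_tail_recurrence; auto; lia.
Qed.

End JostJacobi.

(** * Summability *)

(** [tl n] is the remainder of the series from index n on, so [tl 0] is the whole sum. *)
Lemma series_tail (w : nat -> R) :
  (forall n, 0 <= w n) -> ex_series w ->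
  exists tl : nat -> R, (forall n, tl n - tl (S n) = w n) /\
    (forall n, 0 <= tl n <= tl 0%nat) /\ is_lim_seq tl 0.
Proof.
intros Hw Hex.
set (tl := fun n => Series w - match n with O => 0 | S i => sum_n w i end).
exists tl.
assert (Hd : forall n, tl n - tl (S n) = w n).
{ intros [|n]; unfold tl.
  - rewrite sum_O; ring.
  - rewrite sum_Sn; unfold plus; simpl; ring. }
assert (Hdec : forall n, tl (S n) <= tl n)
  by (intros n; generalize (Hd n) (Hw n); lra).
assert (Hlim : is_lim_seq tl 0).
{ apply is_lim_seq_incr_1; unfold tl.
  replace 0 with (Series w - Series w) by ring.
  apply is_lim_seq_minus'; [apply is_lim_seq_const|exact (Series_correct _ Hex)]. }
split; [exact Hd|split; [|exact Hlim]].
intros n; split.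
- exact (is_lim_seq_decr_compare _ _ Hlim Hdec n).
- induction n as [|n IH]; [lra|generalize (Hdec n); lra].
Qed.

Lemma alpha_lim (am1 : R) (a : nat -> R) :
  (forall n, 0 < a n) -> is_lim_seq a p_infty -> is_lim_seq (alpha am1 a) 0.
Proof.
intros ha Ha; apply is_lim_seq_spec; intros eps.
destruct (proj2 (is_lim_seq_spec _ _) Ha (/ eps)) as [N HN].
(* The shift by one puts both a_(n-1) and a_n above 1 / eps. *)
exists (S N); intros n Hn; destruct n as [|n]; [lia|].
assert (He := Rinv_0_lt_compat _ (cond_pos eps)).
assert (H1 := HN n ltac:(lia)). assert (H2 := HN (S n) ltac:(lia)).
assert (Hs : / eps <= sqrt (a n * a (S n))).
{ rewrite <- (sqrt_square (/ eps)) by lra; apply sqrt_le_1_alt; nra. }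
unfold alpha; simpl prev; rewrite Rminus_0_r.
assert (Hp : 0 < 2 * sqrt (a n * a (S n))) by lra.
unfold Rdiv; rewrite Rmult_1_l.
rewrite Rabs_pos_eq by (apply Rlt_le, Rinv_0_lt_compat, Hp).
rewrite <- (Rinv_inv eps); apply Rinv_lt_contravar; [|lra].
apply Rmult_lt_0_compat; lra.
Qed.

Lemma z__near (am1 : R) (a b : nat -> R) (binf rho0 eps0 : R) :
  (forall n, 0 < a n) -> 0 < am1 -> is_lim_seq a p_infty ->
  is_lim_seq (beta am1 a b) binf -> 0 < rho0 -> 0 < eps0 ->
  exists N, forall n z, (N <= n)%nat -> Cmod z < rho0 ->
    Cmod (z_ am1 a b n z - RtoC binf)%C < eps0.
Proof.
intros ha ham1 Ha Hb Hr He.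
assert (He1 : 0 < eps0 / 2 / rho0) by (apply Rdiv_lt_0_compat; lra).
assert (He2 : 0 < eps0 / 2) by lra.
destruct (proj2 (is_lim_seq_spec _ _) (alpha_lim am1 a ha Ha) (mkposreal _ He1))
  as [N1 H1].
destruct (proj2 (is_lim_seq_spec _ _) Hb (mkposreal _ He2)) as [N2 H2].
simpl in H1, H2.
exists (N1 + N2)%nat; intros n z Hn Hz.
specialize (H1 n ltac:(lia)). specialize (H2 n ltac:(lia)).
rewrite Rminus_0_r in H1.
replace (z_ am1 a b n z - RtoC binf)%C
  with (RtoC (alpha am1 a n) * z + RtoC (beta am1 a b n - binf))%C
  by (unfold z_; rewrite RtoC_minus; ring).
eapply Rle_lt_trans; [apply Cmod_triangle|].
rewrite Cmod_mult, !Cmod_R.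
assert (H3 : Rabs (alpha am1 a n) * Cmod z <= eps0 / 2 / rho0 * rho0).
{ apply Rmult_le_compat; [apply Rabs_pos|apply Cmod_ge_0|lra|lra]. }
replace (eps0 / 2 / rho0 * rho0) with (eps0 / 2) in H3 by (field; lra).
lra.
Qed.

Lemma closed_half_plane_z_ (am1 : R) (a b : nat -> R) (binf : R) (e : edge) (z : C)
  (n : nat) : 0 < am1 -> (forall n, 0 < a n) ->
  z_domain binf e z -> z_domain binf e (z_ am1 a b n z).
Proof.
intros ham1 ha H Hb; specialize (H Hb); unfold closed_half_plane in *.
assert (Ha := alpha_pos am1 a ham1 ha n).
replace (Im (z_ am1 a b n z)) with (alpha am1 a n * Im z)
  by (unfold z_; destruct z; simpl; ring).
rewrite <- Rmult_assoc, (Rmult_comm (side e)), Rmult_assoc.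
apply Rmult_le_pos; lra.
Qed.

(** Two successive increments of z_n are included because sigma_n couples zeta_n with zeta_(n-1);
    the bound [rho0] for |z| makes the majorant independent of z. *)
Lemma coefficient_variation_tail (am1 : R) (a b : nat -> R) (rho0 : R) :
  0 < rho0 ->
  ex_series (fun n => Rabs (alpha am1 a (S n) - alpha am1 a n)) ->
  ex_series (fun n => Rabs (beta am1 a b (S n) - beta am1 a b n)) ->
  ex_series (fun n => Rabs (kk am1 a n - 1)) ->
  exists tl : nat -> R, (forall n, 0 <= tl n <= tl 0%nat) /\ is_lim_seq tl 0 /\
    forall n z, Cmod z < rho0 ->
      Cmod (z_ am1 a b (S n) z - z_ am1 a b n z)%C
      + Cmod (z_ am1 a b (S (S n)) z - z_ am1 a b (S n) z)%C
      + Rabs (kk am1 a (S n) - 1) <= tl n - tl (S n).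
Proof.
intros Hr HA HB HK.
set (nu := fun n => Rabs (alpha am1 a (S n) - alpha am1 a n) * rho0
                    + Rabs (beta am1 a b (S n) - beta am1 a b n)).
assert (Hnu : ex_series nu).
{ apply (ex_series_plus (V := R_NormedModule)); [|exact HB].
  apply (ex_series_scal_r rho0), HA. }
assert (Hnu0 : forall n, 0 <= nu n).
{ intros n; unfold nu.
  generalize (Rabs_pos (beta am1 a b (S n) - beta am1 a b n))
    (Rmult_le_pos _ _ (Rabs_pos (alpha am1 a (S n) - alpha am1 a n))
       (Rlt_le _ _ Hr)); lra. }
destruct (series_tail (fun n => nu n + nu (S n) + Rabs (kk am1 a (S n) - 1)))
  as (tl & H1 & H2 & H3).
- intros n; generalize (Hnu0 n) (Hnu0 (S n)) (Rabs_pos (kk am1 a (S n) - 1)); lra.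
- apply (ex_series_plus (V := R_NormedModule));
    [apply (ex_series_plus (V := R_NormedModule))|].
  + exact Hnu.
  + apply (ex_series_incr_1 nu), Hnu.
  + apply (ex_series_incr_1 (fun n => Rabs (kk am1 a n - 1))), HK.
- exists tl; split; [exact H2|split; [exact H3|]]; intros n z Hz.
  assert (Hz_ : forall m, Cmod (z_ am1 a b (S m) z - z_ am1 a b m z)%C <= nu m).
  { intros m.
    replace (z_ am1 a b (S m) z - z_ am1 a b m z)%C
      with (RtoC (alpha am1 a (S m) - alpha am1 a m) * z
            + RtoC (beta am1 a b (S m) - beta am1 a b m))%C
      by (unfold z_; rewrite !RtoC_minus; ring).
    eapply Rle_trans; [apply Cmod_triangle|].
    rewrite Cmod_mult, !Cmod_R; unfold nu; apply Rplus_le_compat_r.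
    apply Rmult_le_compat_l; [apply Rabs_pos|lra]. }
  rewrite H1; generalize (Hz_ n) (Hz_ (S n)); lra.
Qed.

(** * Choice of the constants and transfer of regularity to the given solution *)

Theorem theorem4p2
  (am1 : R) (a b : nat -> R) (binf : R)
  (ham1 : 0 < am1) (ha : forall n : nat, 0 < a n)
  (ha_infty : is_lim_seq a p_infty)
  (hbeta : is_lim_seq (beta am1 a b) binf)
  (hbinf : Rabs binf <> 1)
  (halpha' : ex_series (fun n => Rabs (alpha am1 a (S n) - alpha am1 a n)))
  (hbeta' : ex_series (fun n => Rabs (beta am1 a b (S n) - beta am1 a b n)))
  (hk : ex_series (fun n => Rabs (kk am1 a n - 1)))
  (rho0 : R) (hrho0 : 0 < rho0)
  (eps0 : R) (heps0 : 0 < eps0 < Rabs (Rabs binf - 1)) :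
  exists N1 : nat, (1 <= N1)%nat /\
  forall N0 : nat, (N1 <= N0)%nat ->
    (forall (n : nat) (z : C), (N0 <= n)%nat -> Cmod z < rho0 ->
       Cmod (z_ am1 a b n z - RtoC binf)%C < eps0) /\
    forall e : edge,
      (forall z : C, Cmod z < rho0 -> z_domain binf e z ->
         exists v : nat -> C, bounded_solution am1 a b N0 e z v /\
           forall w : nat -> C, bounded_solution am1 a b N0 e z w ->
             forall n : nat, (N0 <= n)%nat -> w n = v n) /\
      forall u : C -> nat -> C,
        (forall z : C, Cmod z < rho0 -> z_domain binf e z ->
           bounded_solution am1 a b N0 e z (u z)) ->
        let f := jost am1 a b N0 e u in
        (forall z : C, Cmod z < rho0 -> z_domain binf e z ->
           jacobi_equation am1 a b z (f z) /\
           jost_asymptotics am1 a b N0 e z (f z)) /\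
        (1 < Rabs binf -> forall n : Z, (-1 <= n)%Z ->
           analytic_on (fun z => Cmod z < rho0) (fun z => f z n)) /\
        (Rabs binf < 1 -> forall n : Z, (-1 <= n)%Z ->
           analytic_on (fun z => Cmod z < rho0 /\ open_half_plane e z)
                       (fun z => f z n) /\
           @continuous_on C_UniformSpace C_UniformSpace
             (fun z => Cmod z < rho0 /\ closed_half_plane e z)
             (fun z => f z n)).
Proof.
destruct (one_sub_zeta_mul_bound binf eps0 heps0) as (c & Hc & Hcz).
destruct (coefficient_variation_tail am1 a b rho0 hrho0 halpha' hbeta' hk)
  as (tl & Htot & Htl & Hvar).
destruct (z__near am1 a b binf rho0 eps0 ha ham1 ha_infty hbeta hrho0 (proj1 heps0))
  as [N2 Hnear].
(* From |1 / zeta| <= 2 |z_n| + 1 and |z_n| < |binf| + eps0. *)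
set (Bz := 2 * (Rabs binf + eps0) + 1).
set (CK := kernel_const c Bz (tl 0%nat) * (3 + 2 / c)).
assert (HBz : forall e n z, (N2 <= n)%nat -> Cmod z < rho0 ->
  Cmod (/ zeta_ am1 a b e z n)%C <= Bz).
{ intros e n z Hn Hz.
  eapply Rle_trans; [apply Cmod_Cinv_zeta_le|].
  assert (H := Hnear n z Hn Hz).
  assert (T := Cmod_triangle (z_ am1 a b n z - RtoC binf)%C (RtoC binf)).
  replace (z_ am1 a b n z - RtoC binf + RtoC binf)%C with (z_ am1 a b n z) in T by ring.
  rewrite Cmod_R in T; unfold Bz; lra. }
assert (HCK : 0 <= CK).
{ unfold CK, kernel_const.
  assert (Hi := Rinv_0_lt_compat c Hc). assert (Hexp := exp_pos (tl 0%nat)).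
  assert (H0 := proj1 (Htot 0%nat)).
  assert (Hi3 : 0 < / (c * c * c)).
  { apply Rinv_0_lt_compat; repeat apply Rmult_lt_0_compat; exact Hc. }
  assert (HB : 0 <= Bz) by (unfold Bz; generalize (Rabs_pos binf); lra).
  clearbody Bz.
  repeat (apply Rmult_le_pos || apply Rplus_le_le_0_compat);
    lra. }
set (rho := fun n => CK * tl n).
assert (Hrho_pos : forall n, 0 <= rho n)
  by (intros n; apply Rmult_le_pos; [exact HCK|apply Htot]).
assert (Hrho_lim : is_lim_seq rho 0).
{ apply is_lim_seq_scal_0, Htl. }
assert (Hrho_dec : forall n, rho (S n) <= rho n).
{ intros n; apply Rmult_le_compat_l; [exact HCK|].
  assert (H := Hvar n 0%C ltac:(rewrite Cmod_0; exact hrho0)).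
  generalize (Cmod_ge_0 (z_ am1 a b (S n) 0 - z_ am1 a b n 0)%C)
    (Cmod_ge_0 (z_ am1 a b (S (S n)) 0 - z_ am1 a b (S n) 0)%C)
    (Rabs_pos (kk am1 a (S n) - 1)); lra. }
assert (Hhalf : 0 < 1 / 2) by lra.
destruct (proj2 (is_lim_seq_spec _ _) Hrho_lim (mkposreal _ Hhalf)) as [N3 HN3].
simpl in HN3.
(* [N2] keeps z_n near [binf], [N3] makes the operator norm at most 1/2, and the successor ensures
   N0 >= 1, so that [pred] is a true predecessor. *)
exists (S (N2 + N3)); split; [lia|]; intros N0 HN0.
assert (HrhoN : rho N0 <= 1 / 2).
{ assert (H := HN3 N0 ltac:(lia)); rewrite Rminus_0_r in H.
  apply Rabs_def2 in H; lra. }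
split; [intros n z Hn; apply Hnear; lia|].
intros e.
set (D := fun z => Cmod z < rho0 /\ z_domain binf e z).
set (K := fun z n m => (G am1 a b e z n m * r am1 a b e z m)%C).
assert (HcD : forall n m z w, (N0 <= n)%nat -> (N0 <= m)%nat -> D z -> D w ->
  c <= Cmod (1 - zeta_ am1 a b e z n * zeta_ am1 a b e w m)%C).
{ intros n m z w Hn Hm [Hz Dz] [Hw Dw]; apply Hcz.
  - apply Hnear; [lia|exact Hz].
  - apply closed_half_plane_z_; assumption.
  - apply closed_half_plane_z_; assumption. }
assert (HK : forall z, D z -> forall n j, (N0 <= n)%nat ->
  Cmod (K z n (S n + j)%nat) <= rho (n + j)%nat - rho (S (n + j))).
{ intros z Dz n j Hn; unfold rho; rewrite <- Rmult_minus_distr_l.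
  apply (kernel_bound am1 a b ha e z N0 c Bz (tl 0%nat) tl Hc); auto.
  - intros i Hi; apply HBz; [lia|apply Dz].
  - intros i; apply Hvar, Dz. }
assert (Hsol : forall z, D z -> exists v, bounded_solution am1 a b N0 e z v /\
  (forall k n, (N0 <= n)%nat ->
     Cmod (v n - picard (K z) k n)%C <= halving 3 2 rho k) /\
  forall w, bounded_solution am1 a b N0 e z w -> forall n, (N0 <= n)%nat -> w n = v n).
{ intros z Dz.
  destruct (volterra_existence (K z) rho N0 Hrho_pos Hrho_dec Hrho_lim HrhoN (HK z Dz))
    as (v & Hv & Hvk).
  (* The zeroth iterate is 1 and [halving] starts at 3, so |v n| <= 4. *)
  assert (HvB : forall n, (N0 <= n)%nat -> Cmod (v n) <= 5).
  { intros n Hn; assert (H := Hvk 0%nat n Hn); simpl in H.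
    replace (v n) with ((v n - 1) + 1)%C by ring.
    eapply Rle_trans; [apply Cmod_triangle|]; rewrite Cmod_1; lra. }
  exists v; split; [split; [exists 5; exact HvB|exact Hv]|split; [exact Hvk|]].
  intros w [[M HM] Hw].
  exact (volterra_uniqueness (K z) rho N0 Hrho_pos Hrho_dec Hrho_lim HrhoN (HK z Dz)
           w v M 5 HM Hw HvB Hv). }
split.
{ intros z Hz Dz; destruct (Hsol z (conj Hz Dz)) as (v & H1 & _ & H2); eauto. }
intros u Hu f.
assert (HuD : forall z, D z -> bounded_solution am1 a b N0 e z (u z))
  by (intros z [Hz Dz]; auto).
split.
{ intros z Hz Dz; destruct (HuD z (conj Hz Dz)) as [[M HM] Hv].
  assert (HM0 : 0 <= M)
    by exact (Rle_trans _ _ _ (Cmod_ge_0 _) (HM N0 (Nat.le_refl N0))).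
  split; [apply jost_jacobi; auto; lia|].
  exists (fun n => u z n - 1)%C; split.
  - apply (clim_filterlim eventually), clim_sub_0.
    exact (volterra_solution_lim (K z) rho N0 Hrho_pos Hrho_dec Hrho_lim
             (HK z (conj Hz Dz)) (u z) M HM0 HM Hv).
  - intros n Hn; unfold f; rewrite jost_ge by lia; unfold jost_tail; ring. }
assert (HulC : forall n, (N0 <= n)%nat -> C1_limit_on D (fun z => u z n)).
{ intros n Hn; exists (fun k z => picard (K z) k n); split.
  - intros k; apply (C1_picard D K N0); [|exact Hn].
    intros i m Hi Hm; apply (C1_kernel am1 a b e N0 D c Hc); auto.
  - intros z0 _; exists 1, (halving 3 2 rho); split; [lra|split].
    + apply halving_lim; auto; lra.
    (* Nothing is assumed about how [u] depends on z; uniqueness identifies it pointwise with the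
       limit of the iterates, at a rate uniform on [D]. *)
    + intros k z Dz _; destruct (Hsol z Dz) as (v & _ & H1 & H2).
      rewrite (H2 (u z) (HuD z Dz) n Hn).
      replace (picard (K z) k n - v n)%C with (- (v n - picard (K z) k n))%C by ring.
      rewrite Cmod_opp; apply H1, Hn. }
assert (HfC : forall n, C1_limit_on D (fun z => f z n)).
{ apply (jost_C1_limit am1 a b e N0 D c Hc); auto. }
split.
- intros Hb n _ z Hz.
  apply (C1_limit_ex_derive D _ z (rho0 - Cmod z)); [lra| |apply HfC].
  (* For |binf| > 1 the half-plane condition is vacuous, so discs around real points also lie in
     [D]. *)
  intros w Hw; split; [|intros H; lra].
  replace w with ((w - z) + z)%C by ring.
  eapply Rle_lt_trans; [apply Cmod_triangle|lra].
- intros Hb n _; split.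
  + intros z [Hz Hopen]; unfold open_half_plane in Hopen.
    (* The second radius is the distance from z to the real line, which keeps the disc on the side
       of [e]. *)
    apply (C1_limit_ex_derive D _ z (Rmin (rho0 - Cmod z) (side e * Im z)));
      [apply Rmin_pos; lra| |apply HfC].
    intros w Hw.
    assert (Hw1 := Rlt_le_trans _ _ _ Hw (Rmin_l _ _)).
    assert (Hw2 := Rlt_le_trans _ _ _ Hw (Rmin_r _ _)).
    split.
    * replace w with ((w - z) + z)%C by ring.
      eapply Rle_lt_trans; [apply Cmod_triangle|lra].
    * intros _; unfold closed_half_plane.
      assert (Hi := Rle_lt_trans _ _ _ (im_le_Cmod (w - z)%C) Hw2).
      replace (Im (w - z)%C) with (Im w - Im z) in Hi by (destruct w, z; reflexivity).
      apply Rabs_def2 in Hi; destruct e; simpl in *; lra.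
  + apply C1_limit_continuous.
    destruct (HfC n) as (fk & F1 & F2); exists fk; split.
    * intros k; apply C1_subset with D; [|apply F1].
      intros z [Hz Hcl]; split; [exact Hz|intros _; exact Hcl].
    * intros z0 [Hz0 Hcl0].
      destruct (F2 z0 (conj Hz0 (fun _ => Hcl0))) as (d & e' & Hd & He' & H).
      exists d, e'; repeat split; auto.
      intros k z [Hz Hcl] Hzd; apply H; [|exact Hzd].
      split; [exact Hz|intros _; exact Hcl].
Qed.
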